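(* Let $\Lambda$ be a Nakayama algebra. Then every torsion-free class of $\mathsf{mod}\,\Lambda$, regarded as an exact category, satisfies the Jordan-Hölder property (JHP).
   Context: An artin algebra is an algebra over a fixed commutative artinian ring $R$ that is finitely generated as an $R$-module; $\mathsf{mod}\,\Lambda$ is the category of finitely generated right $\Lambda$-modules. A module is uniserial if its submodules are totally ordered by inclusion. An artin algebra $\Lambda$ is Nakayama if every indecomposable projective right module and every indecomposable projective left module is uniserial. A torsion pair $(\mathcal{T},\mathcal{F})$ in an abelian category $\mathcal{A}$ is a pair of full subcategories closed under isomorphisms such that $\mathcal{A}(T,F)=0$ for all $T\in\mathcal{T}$, $F\in\mathcal{F}$, and every $X\in\mathcal{A}$ has a short exact sequence $0\to TX\to X\to FX\to 0$ with $TX\in\mathcal{T}$, $FX\in\mathcal{F}$. Then $\mathcal{F}$ is called a torsion-free class. It is extension-closed and is regarded as an exact category whose conflations are the short exact sequences of $\mathcal{A}$ with all terms in $\mathcal{F}$. For an exact category $\mathcal{E}$ and an object $X$, $\mathsf{P}(X)$ is the poset of admissible subobjects: its elements are inflations $A\to X$ up to isomorphism over $X$, and $A\leq B$ if there is an inflation $A\to B$ compatible with the inflations to $X$; $X/A$ is the cokernel of $A\to X$. $\mathcal{E}$ is length if for every $X$ the set of lengths of finite chains in $\mathsf{P}(X)$ is bounded (every extension-closed subcategory of $\mathsf{mod}\,\Lambda$ is length). A composition series of $X$ is a finite maximal chain $0=X_0<\cdots<X_n=X$ in $\mathsf{P}(X)$. Two composition series $(X_i)_{i=0}^n$, $(Y_j)_{j=0}^m$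 are isomorphic if $m=n$ and there is a permutation $\sigma$ of $\{1,\dots,n\}$ with $X_i/X_{i-1}\cong Y_{\sigma(i)}/Y_{\sigma(i)-1}$ for all $i$. A length exact category satisfies (JHP) if for every object $X$ all composition series of $X$ are isomorphic to each other. *)

(* Defs.v *)
From mathcomp Require Import all_boot all_algebra.
From mathcomp Require Import boolp classical_sets.

Set Implicit Arguments.
Unset Strict Implicit.
Unset Printing Implicit Defensive.

Import GRing.Theory.
Local Open Scope classical_set_scope.
Local Open Scope ring_scope.

(** An [lmodType A] is a left [A]-module.  A right [A]-module is a left module
    over the converse ring [A^c], where [a *: x] stands for [x . a].  Rings may
    be zero ([pzRingType]).  Submodules are classical sets, so that they are not
    restricted to decidable subsets. *)

Section Modules.
Variable A : pzRingType.

Definition submodule (M : lmodType A) (U : set M) : Prop :=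
  GRing.submod_closed [in U].

Definition fin_gen (M : lmodType A) : Prop :=
  exists (n : nat) (e : 'I_n -> M),
    forall x : M, exists c : 'I_n -> A, x = \sum_(i < n) c i *: e i.

Definition artinian (M : lmodType A) : Prop :=
  forall U : nat -> set M,
    (forall n, submodule (U n)) -> (forall n, U n.+1 `<=` U n) ->
    exists n, forall m, (n <= m)%N -> U m = U n.

Definition uniserial (M : lmodType A) : Prop :=
  forall U V : set M, submodule U -> submodule V -> U `<=` V \/ V `<=` U.

Definition zero_module (M : lmodType A) : Prop := forall x : M, x = 0.

Definition indecomposable (M : lmodType A) : Prop :=
  ~ zero_module M /\
  forall U V : set M, submodule U -> submodule V ->
    U `&` V = [set 0] -> (forall x, exists2 u, U u & exists2 v, V v & x = u + v) ->
    U = [set 0] \/ V = [set 0].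

Definition projective (P : lmodType A) : Prop :=
  forall (M N : lmodType A) (g : {linear M -> N}) (f : {linear P -> N}),
    range g = [set: N] -> exists h : {linear P -> M}, forall x, g (h x) = f x.

Definition isomorphic (M N : lmodType A) : Prop :=
  exists f : {linear M -> N}, bijective f.

Definition short_exact (K M N : lmodType A)
    (i : {linear K -> M}) (p : {linear M -> N}) : Prop :=
  [/\ injective i, range p = [set: N] & range i = p @^-1` [set 0]].

End Modules.

(** The objects of the category of finitely generated [A]-modules; its full
    subcategories are given by predicates on them. *)
Record fgmod (A : pzRingType) := FgMod {
  fgmod_sort :> lmodType A;
  fgmod_fin_gen : fin_gen fgmod_sort }.

Section TorsionPairs.
Variable A : pzRingType.
Implicit Types E T F : fgmod A -> Prop.

Definition iso_closed E : Prop :=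
  forall M N : fgmod A, isomorphic M N -> E M -> E N.

Definition torsion_pair T F : Prop :=
  [/\ iso_closed T, iso_closed F,
      forall (M N : fgmod A) (f : {linear M -> N}), T M -> F N -> forall x, f x = 0
    & forall X : fgmod A, exists (TX FX : fgmod A)
        (i : {linear TX -> X}) (p : {linear X -> FX}),
        [/\ T TX, F FX & short_exact i p]].

Definition torsion_free_class F : Prop := exists T, torsion_pair T F.

End TorsionPairs.

Section ExactStructure.
Variables (A : pzRingType) (E : fgmod A -> Prop).

(** The exact structure that an extension-closed full subcategory [E] inherits
    from the abelian category of finitely generated modules: conflations are
    the short exact sequences all of whose terms are in [E]. *)
Definition conflation (K M N : fgmod A)
    (i : {linear K -> M}) (p : {linear M -> N}) : Prop :=
  [/\ E K, E M, E N & short_exact i p].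

Definition inflation (K M : fgmod A) (i : {linear K -> M}) : Prop :=
  exists (N : fgmod A) (p : {linear M -> N}), conflation i p.

(** Representatives of the elements of the poset of admissible subobjects of
    [X]; equality in the poset is [subobj_eq], isomorphism over [X]. *)
Record subobj (X : fgmod A) := Subobj {
  subobj_dom : fgmod A;
  subobj_map : {linear subobj_dom -> X};
  subobj_inflation : inflation subobj_map }.

Section Subobjects.
Variable X : fgmod A.
Implicit Types U V : subobj X.

Definition over U V (h : {linear subobj_dom U -> subobj_dom V}) : Prop :=
  forall x, subobj_map V (h x) = subobj_map U x.

Definition subobj_eq U V : Prop :=
  exists h : {linear subobj_dom U -> subobj_dom V}, bijective h /\ over h.

Definition subobj_le U V : Prop :=
  exists h : {linear subobj_dom U -> subobj_dom V}, inflation h /\ over h.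

Definition subobj_lt U V : Prop := subobj_le U V /\ ~ subobj_eq U V.

(** [C] is (isomorphic to) the cokernel [V / U] of the inflation witnessing
    [subobj_le U V]. *)
Definition is_factor U V (C : fgmod A) : Prop :=
  exists (h : {linear subobj_dom U -> subobj_dom V})
         (p : {linear subobj_dom V -> C}), over h /\ conflation h p.

(** The chain [0 = s 0 < s 1 < ... < s n = X], maximal among all chains: an
    admissible subobject comparable to all its members is one of them. *)
Definition composition_series (n : nat) (s : 'I_n.+1 -> subobj X) : Prop :=
  [/\ zero_module (subobj_dom (s ord0)),
      bijective (subobj_map (s ord_max)),
      forall i j : 'I_n.+1, (i < j)%N -> subobj_lt (s i) (s j)
    & forall U, (forall i, subobj_le U (s i) \/ subobj_le (s i) U) ->
        exists i, subobj_eq U (s i)].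

(** For [i : 'I_n], the factor of index [i] is [s i.+1 / s i]. *)
Definition series_isomorphic (n m : nat)
    (s : 'I_n.+1 -> subobj X) (t : 'I_m.+1 -> subobj X) : Prop :=
  m = n /\
  exists sigma : 'I_n -> 'I_m, bijective sigma /\
    forall i : 'I_n, exists C D : fgmod A,
      [/\ is_factor (s (widen_ord (leqnSn n) i)) (s (lift ord0 i)) C,
          is_factor (t (widen_ord (leqnSn m) (sigma i))) (t (lift ord0 (sigma i))) D
        & isomorphic C D].

End Subobjects.

Definition JHP : Prop :=
  forall X : fgmod A, E X ->
  forall (n m : nat) (s : 'I_n.+1 -> subobj X) (t : 'I_m.+1 -> subobj X),
    composition_series s -> composition_series t -> series_isomorphic s t.

End ExactStructure.

(** An [R]-algebra is a ring [L] with a ring morphism from [R] to the center of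
    [L].  (The library's [algType R] would exclude the zero algebra.) *)
Definition artin_algebra (R : comPzRingType) (L : pzRingType)
    (iota : {rmorphism R -> L}) : Prop :=
  [/\ artinian (R^o : lmodType R),
      forall r x, iota r * x = x * iota r
    & exists (n : nat) (e : 'I_n -> L),
        forall x : L, exists c : 'I_n -> R, x = \sum_(i < n) iota (c i) * e i].

Definition proj_indec_uniserial (A : pzRingType) : Prop :=
  forall P : fgmod A, projective P -> indecomposable P -> uniserial P.

Definition nakayama (L : pzRingType) : Prop :=
  proj_indec_uniserial L^c /\ proj_indec_uniserial L.

(* Main.v *)
(** In a torsion-free class [F] the admissible subobjects of [X] are the
    submodules [W] with [X / W] in [F]; they are closed under intersection.  The
    composition factors are the subquotients [V / W] that are simple in [F], and
    the theorem follows by induction from the comparison of two such factors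
    [V / W] and [V / W'] with [W <> W'].  If [W + W' = V], then [V / W] is
    isomorphic to [W' / (W & W')] and [V / W'] to [W / (W & W')].

    If [W + W' <> V], we show that [V / W] and [V / W'] are isomorphic through an
    isomorphism preserving [W + W'], so that [W / (W & W')] and [W' / (W & W')]
    are isomorphic as well.  Over a Nakayama algebra, a cyclic submodule
    [A x], [x = e x] with [e] a primitive idempotent, of maximal Loewy length is
    a direct summand; hence a simple object of [F] has the form [A x].  As
    [V / W] and [V / W'] have the nonzero quotient [V / (W + W')] in common, one
    and the same [x = e x] generates both.  The annihilators of [x] in
    these two quotients are comparable, [A e] being uniserial, so one of
    the quotients surjects onto the other, compatibly with the projections onto
    [V / (W + W')]; both being simple in [F], this is an isomorphism.

    Right modules over [L] are left modules over [A = L^c]. *)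
Require Import Defs.
From HB Require Import structures.
From mathcomp Require Import all_boot all_algebra perm.
From mathcomp Require Import boolp classical_sets.

Set Implicit Arguments.
Unset Strict Implicit.
Unset Printing Implicit Defensive.

Import GRing.Theory.
Local Open Scope classical_set_scope.
Local Open Scope ring_scope.

(** * Submodules and artinian modules *)

Section Submodules.
Variables (A : pzRingType) (M : lmodType A).
Implicit Types (U V W : set M) (x y : M).

Lemma submoduleP U :
  submodule U <-> U 0 /\ forall a x y, U x -> U y -> U (a *: x + y).
Proof.
split=> [[]|[U0 UD]].
  rewrite /= inE => U0 UD; split=> // a x y Ux Uy.
  by rewrite -in_setE; apply: UD; rewrite in_setE.
split; first by rewrite /= in_setE.
by move=> a x y; rewrite /= !in_setE => Ux Uy; apply: UD.
Qed.

Lemma submodule0 U : submodule U -> U 0.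
Proof. by move=> /submoduleP[]. Qed.

Lemma submoduleZ U a x : submodule U -> U x -> U (a *: x).
Proof. by move=> /submoduleP[U0 UD] Ux; rewrite -[_ *: _]addr0; apply: UD. Qed.

Lemma submoduleD U x y : submodule U -> U x -> U y -> U (x + y).
Proof. by move=> /submoduleP[U0 UD] Ux; rewrite -[x]scale1r; apply: UD. Qed.

Lemma submoduleN U x : submodule U -> U x -> U (- x).
Proof. by move=> sU Ux; rewrite -scaleN1r; apply: submoduleZ. Qed.

Lemma submoduleB U x y : submodule U -> U x -> U y -> U (x - y).
Proof. by move=> sU Ux Uy; apply: submoduleD => //; apply: submoduleN. Qed.

Lemma submodule_sum U I (r : seq I) (P : pred I) (F : I -> M) :
  submodule U -> (forall i, P i -> U (F i)) -> U (\sum_(i <- r | P i) F i).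
Proof.
move=> sU UF; elim/big_ind: _ => //; first exact: submodule0.
by move=> x y; apply: submoduleD.
Qed.

Lemma submodule_set0 : submodule [set 0 : M].
Proof. by apply/submoduleP; split=> // a x y /= -> ->; rewrite scaler0 addr0. Qed.

Lemma submodule_setT : submodule [set: M].
Proof. by apply/submoduleP; split. Qed.

Lemma submoduleI U V : submodule U -> submodule V -> submodule (U `&` V).
Proof.
move=> /submoduleP[U0 UD] /submoduleP[V0 VD]; apply/submoduleP; split=> //.
by move=> a x y [? ?] [? ?]; split; [apply: UD|apply: VD].
Qed.

Definition sumset U V : set M := [set x | exists2 u, U u & exists2 v, V v & x = u + v].

Lemma submodule_sumset U V : submodule U -> submodule V -> submodule (sumset U V).
Proof.
move=> /submoduleP[U0 UD] /submoduleP[V0 VD]; apply/submoduleP; split.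
  by exists 0 => //; exists 0 => //; rewrite addr0.
move=> a _ _ [u Uu [v Vv ->]] [u' Uu' [v' Vv' ->]].
exists (a *: u + u'); first exact: UD.
exists (a *: v + v'); first exact: VD.
by rewrite scalerDr addrACA.
Qed.

Lemma sumset_subl U V : V 0 -> U `<=` sumset U V.
Proof. by move=> V0 x Ux; exists x => //; exists 0 => //; rewrite addr0. Qed.

Lemma sumset_subr U V : U 0 -> V `<=` sumset U V.
Proof. by move=> U0 x Vx; exists 0 => //; exists x => //; rewrite add0r. Qed.

Lemma sumset_min U V W : submodule W -> U `<=` W -> V `<=` W -> sumset U V `<=` W.
Proof. by move=> sW UW VW _ [u /UW Wu [v /VW Wv ->]]; apply: submoduleD. Qed.

Lemma sumsetC U V : sumset U V = sumset V U.
Proof.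
by apply/seteqP; split=> _ [u Uu [v Vv ->]]; exists v => //; exists u => //;
  rewrite addrC.
Qed.

Lemma sumset0 U : sumset U [set 0] = U.
Proof.
apply/seteqP; split=> [_ [u Uu [_ -> ->]]|u Uu]; first by rewrite addr0.
by exists u => //; exists 0; rewrite ?addr0.
Qed.

Definition cyclic x : set M := [set y | exists a, y = a *: x].

Lemma submodule_cyclic x : submodule (cyclic x).
Proof.
apply/submoduleP; split; first by exists 0; rewrite scale0r.
by move=> a _ _ [b ->] [c ->]; exists (a * b + c); rewrite scalerDl scalerA.
Qed.

Lemma cyclic_id x : cyclic x x.
Proof. by exists 1; rewrite scale1r. Qed.

Lemma cyclic_min U x : submodule U -> U x -> cyclic x `<=` U.
Proof. by move=> sU Ux _ [a ->]; apply: submoduleZ. Qed.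

Definition spanset (S : set M) : set M :=
  [set x | forall K, submodule K -> S `<=` K -> K x].

Lemma submodule_spanset S : submodule (spanset S).
Proof.
apply/submoduleP; split=> [K sK _|a x y Sx Sy K sK SK]; first exact: submodule0.
by apply: submoduleD => //; [apply: submoduleZ => //; apply: Sx|apply: Sy].
Qed.

Lemma spanset_sub S : S `<=` spanset S.
Proof. by move=> x Sx K _; apply. Qed.

Lemma spanset_min S U : submodule U -> S `<=` U -> spanset S `<=` U.
Proof. by move=> sU SU x; apply. Qed.

(** Well-founded induction: every counterexample contains a strictly smaller one, and choosing them
    successively gives a descending chain that never becomes stationary. *)
Lemma artinian_ind (Q : set M -> Prop) : artinian M ->
  (forall K, submodule K ->
    (forall K', submodule K' -> K' `<=` K -> K' <> K -> Q K') -> Q K) ->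
  forall K, submodule K -> Q K.
Proof.
move=> artM IH K0 sK0; apply: contrapT => nQ0.
pose T := {K : set M | submodule K /\ ~ Q K}.
have next (K : T) : {K' : T | sval K' `<=` sval K /\ sval K' <> sval K}.
  apply: cid; apply: contrapT => noK'; case: K noK' => K [sK nQK] /= noK'.
  apply: nQK; apply: IH => // K' sK' K'K neK; apply: contrapT => nQK'.
  by apply: noK'; exists (exist _ K' (conj sK' nQK')).
pose u := fix u n : T := if n is m.+1 then sval (next (u m)) else exist _ K0 (conj sK0 nQ0).
have [n||n unE] := artM (fun n => sval (u n)).
- by case: (u n) => K [].
- by move=> n /=; case: (next _) => K' [].
have /= := unE n.+1 (leqnSn n).
by case: (next _) => K' [].
Qed.

End Submodules.

(** * Primitive idempotents and the radical of a serial ring *)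

Section Idempotents.
Variable A : pzRingType.
Implicit Types a b c d e f t u : A.

Definition primitive e : Prop :=
  [/\ e <> 0, e * e = e & forall f, f * f = f -> e * f = f -> f * e = f -> f = 0 \/ f = e].

(** Comparability of the cyclic submodules of [A e], expressed by divisibility in the ring; this
    amounts to [A e] being uniserial. *)
Definition left_uniserial e : Prop := forall a b, a * e = a -> b * e = b ->
  (exists c, a = c * b) \/ (exists c, b = c * a).

Definition right_uniserial e : Prop := forall a b, e * a = a -> e * b = b ->
  (exists c, a = b * c) \/ (exists c, b = a * c).

Lemma regularZ a b : a *: (b : A^o) = a * b :> A. Proof. by []. Qed.

Lemma primitive_neq0 e : primitive e -> e <> 0. Proof. by case. Qed.

Lemma primitive_idem e : primitive e -> e * e = e. Proof. by case. Qed.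

(** Induction on the left ideal [A e]: a nontrivial idempotent [f] of [e A e] splits [e] as
    [f + (e - f)], and both summands generate strictly smaller left ideals. *)
Lemma artinian_sum_primitive e : artinian (A^o : lmodType A) -> e * e = e ->
  exists es : seq A, (forall f, f \in es -> primitive f) /\ e = \sum_(f <- es) f.
Proof.
move=> artA ee.
pose Q (K : set (A^o : lmodType A)) := forall e, e * e = e -> K = cyclic (e : A^o) ->
  exists es : seq A, (forall f, f \in es -> primitive f) /\ e = \sum_(f <- es) f.
suff: forall K, submodule K -> Q K.
  by move=> /(_ _ (submodule_cyclic (e : A^o))); apply.
apply: artinian_ind => // K sK IH {ee}e ee defK.
have [->|/eqP e0] := eqVneq e 0; first by exists [::]; rewrite big_nil.
have [pe|npe] := pselect (primitive e).
  exists [:: e]; rewrite big_seq1; split=> // f.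
  by rewrite inE => /eqP ->.
have [f [ff ef fe f0 fne]] : exists f, [/\ f * f = f, e * f = f, f * e = f, f <> 0 & f <> e].
  apply: contrapT => nof; apply: npe; split=> // f ff ef fe.
  apply: contrapT => /not_orP[f0 fne]; apply: nof; by exists f.
have IHg g : g * g = g -> g * e = g -> g <> e -> e * g = g ->
    exists es : seq A, (forall f, f \in es -> primitive f) /\ g = \sum_(f <- es) f.
  move=> gg ge gne eg.
  apply: (IH (cyclic (g : A^o))) => //; first exact: submodule_cyclic.
    rewrite defK => _ [a ->]; exists (a * g).
    by rewrite !regularZ -mulrA ge.
  rewrite defK => Eg; have [a Ea] : cyclic (g : A^o) e by rewrite Eg; apply: cyclic_id.
  by apply: gne; rewrite -eg {1}Ea regularZ -mulrA gg -regularZ -Ea.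
have [es1 [pes1 E1]] := IHg f ff fe fne ef.
have [||||es2 [pes2 E2]] := IHg (e - f).
- by rewrite mulrBl !mulrBr ee ef fe ff subrr subr0.
- by rewrite mulrBl ee fe.
- by move=> /eqP; rewrite subr_eq addrC -subr_eq subrr => /eqP /esym.
- by rewrite mulrBr ee ef.
exists (es1 ++ es2); rewrite big_cat -E1 -E2 /= addrC subrK; split=> // g.
by rewrite mem_cat => /orP[/pes1|/pes2].
Qed.

Section Serial.
Hypothesis artA : artinian (A^o : lmodType A).
Hypothesis luni : forall e, primitive e -> left_uniserial e.

(** The product [a * b] is an idempotent of [e A e], hence [0] or [e], and [0] would give
    [f = b * (a * b) * a = 0]. *)
Lemma primitive_inv e f a b : primitive e -> primitive f ->
  e * a = a -> a * f = a -> f * b = b -> b * e = b -> b * a = f -> a * b = e.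
Proof.
move=> [e0 ee pe] [f0 ff pf] ea af fb be ba.
case: (pe (a * b)) => //.
- by rewrite mulrA -(mulrA a) ba af.
- by rewrite mulrA ea.
- by rewrite -mulrA be.
by move=> ab0; case: f0; rewrite -ff -ba mulrA -(mulrA b) ab0 mulr0 mul0r.
Qed.

(** Fitting's argument: the chain of the [A a ^+ n] is stationary, so some power [y] of [a]
    satisfies [y = b * (y * y)]. In the uniserial [A e], one of [b * y] and [e - b * y] is a
    multiple of the other: the first case gives [y = 0], the second makes [e] a multiple of [y]. *)
Lemma primitive_local e a : primitive e -> e * a = a -> a * e = a ->
  (exists n, a ^+ n = 0) \/ (exists b, b * a = e).
Proof.
move=> pe ea ae; have ee := primitive_idem pe.
pose U n := cyclic (a ^+ n : A^o).
have [n|n|n Un] := artA (U := U).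
- exact: submodule_cyclic.
- by move=> _ [b ->]; exists (b * a); rewrite exprS !regularZ mulrA.
pose y := a ^+ n.+1.
have [b yE] : exists b, y = b * (y * y).
  have : U (n.+1 + n.+1)%N y.
    rewrite Un; last by rewrite (leq_trans (leqnSn n)) ?leq_addr.
    by exists a; rewrite /y exprS.
  by move=> [b yE]; exists b; rewrite {1}yE -exprD.
have ye : y * e = y by rewrite /y exprSr -mulrA ae.
have bye : (b * y) * e = b * y by rewrite -mulrA ye.
have ebye : (e - b * y) * e = e - b * y by rewrite mulrBl ee bye.
have ey : e * y = y by rewrite /y exprS mulrA ea.
have [[c E]|[c E]] := luni pe bye ebye.
  left; exists n.+1; rewrite -/y yE mulrA E.
  by rewrite -mulrA mulrBl ey -mulrA -yE subrr mulr0.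
right; exists ((1 + c) * b * a ^+ n).
rewrite -mulrA -exprSr -/y -mulrA mulrDl mul1r -E.
by rewrite addrC subrK.
Qed.

(** The Jacobson radical: as each [A e] is local, [t] belongs to it if and only if
    there is no [e] such that [t * e] generates [A e]. *)
Definition radical t : Prop := forall e, primitive e -> ~ exists c, c * (t * e) = e.

Lemma radicalMl a t : radical t -> radical (a * t).
Proof. by move=> Jt e pe [c cE]; apply: (Jt e pe); exists (c * a); rewrite !mulrA in cE *. Qed.

(** For sums: in the uniserial [A e] one of [a * x * e] and [y * e] is a multiple of the other, so
    their sum is a multiple of a single one of them. *)
Lemma submodule_radical : submodule (radical : set (A^o : lmodType A)).
Proof.
apply/submoduleP; split=> [e pe [c]|a x y Jx Jy e pe].
  by rewrite mul0r mulr0 => /esym; apply: primitive_neq0.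
rewrite regularZ => -[c cE].
have xe : a * x * e * e = a * x * e by rewrite -mulrA primitive_idem.
have ye : y * e * e = y * e by rewrite -mulrA primitive_idem.
have [[b bE]|[b bE]] := luni pe xe ye.
  by apply: (Jy _ pe); exists (c * (b + 1)); rewrite -mulrA mulrDl mul1r -bE -mulrDl.
apply: (radicalMl (a := a) Jx pe); exists (c * (1 + b)).
by rewrite -mulrA mulrDl mul1r -bE -mulrDl.
Qed.

Lemma one_sum_primitive :
  exists es : seq A, (forall f, f \in es -> primitive f) /\ 1 = \sum_(f <- es) f.
Proof. by apply: artinian_sum_primitive; rewrite ?mulr1. Qed.

(** Right multiplication by [t] is a map from [A e] to [A f]; outside the radical it is an
    isomorphism, with inverse given by [u]. The idempotent [g] that witnesses [~ radical t] has
    [A g] isomorphic to [A f] through [f * g] and [g * c * t], whence a left inverse of [t], and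
    [primitive_inv] makes it two-sided. *)
Lemma nonradical_inv e f t : primitive e -> primitive f -> e * t = t -> t * f = t ->
  ~ radical t -> exists u, [/\ f * u = u, u * e = u, u * t = f & t * u = e].
Proof.
move=> pe pf et tf nJ; have ee := primitive_idem pe; have ff := primitive_idem pf.
have [g pg [c cE]] : exists2 g, primitive g & exists c, c * (t * g) = g.
  by apply: contrapT => no; apply: nJ => g pg gE; apply: no; exists g.
have gg := primitive_idem pg.
have E : f * g * (g * c * t) = f.
  apply: (@primitive_inv f g (f * g) (g * c * t) pf pg); rewrite ?mulrA ?ff //.
  - by rewrite -mulrA gg.
  - by rewrite gg.
  - by rewrite -mulrA tf.
  - by rewrite -!mulrA (mulrA t) tf cE gg.
pose u := f * g * c * e; exists u.
have ut : u * t = f by rewrite /u -!mulrA et -[RHS]E !mulrA -(mulrA f g g) gg.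
split=> //.
- by rewrite /u !mulrA ff.
- by rewrite /u -mulrA ee.
- by apply: (primitive_inv pe pf); rewrite // /u ?mulrA ?ff // -!mulrA ee.
Qed.

(** Only the products of [n] elements of the radical, without their sums: whether a power of the
    radical kills an element can be tested on products. *)
Fixpoint radical_power n : set A :=
  if n is m.+1 then [set b | exists a t, [/\ radical_power m a, radical t & b = a * t]]
  else [set 1].

Lemma radical_powerM m n b : radical_power (m + n) b ->
  exists a c, [/\ radical_power m a, radical_power n c & b = a * c].
Proof.
elim: n b => [|n IH] b; first by rewrite addn0 => mb; exists b, 1; rewrite mulr1.
rewrite addnS => -[_ [t [/IH[a [c [ma nc ->]]] Jt ->]]].
exists a, (c * t); split=> //; first by exists c, t.
by rewrite mulrA.
Qed.

Lemma radical_powerS n a t : radical_power n a -> radical t -> radical_power n.+1 (a * t).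
Proof. by move=> na Jt; exists a, t. Qed.

Lemma radical_powerSl n b : radical_power n.+1 b ->
  exists t a, [/\ radical t, radical_power n a & b = t * a].
Proof.
rewrite -add1n => /radical_powerM[t [a [[_ [u [-> Ju ->]]] na ->]]].
by exists u, a; rewrite mul1r.
Qed.

(** The powers of the radical become stationary, at [I] say.  If [I <> 0], a left
    ideal minimal among those that [I] does not annihilate is of the form [I * x]
    with [x = e * x] in it; then [x = (e * z * e) * x] for some [z] in [I], and
    [e * z * e] is nilpotent. *)
Lemma radical_nilpotent : exists n, forall a, radical_power n a -> a = 0.
Proof.
pose P n : set (A^o : lmodType A) :=
  @spanset A (A^o : lmodType A) (radical_power n).
have sP n : submodule (P n) by apply: submodule_spanset.
have [//|n|n Pn] := artA (U := P).
  apply: spanset_min => // b /radical_powerSl[t [a [Jt na ->]]].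
  by apply: (@submoduleZ _ _ (P n) t (a : A^o)) => //; apply: spanset_sub.
exists n.+1 => b nb; apply: contrapT => b0.
have PJ : P n.+1 `<=` radical.
  apply: spanset_min; first exact: submodule_radical.
  by move=> _ [a [t [_ Jt ->]]]; apply: radicalMl.
pose Q (K : set (A^o : lmodType A)) :=
  ~ exists a x, [/\ radical_power n.+1 a, K x & a * x <> 0].
suff /(_ setT) QT : forall K, submodule K -> Q K.
  apply: QT; first exact: submodule_setT.
  by exists b, 1; rewrite mulr1.
apply: artinian_ind => // K sK IH [a [y [na Ky ay0]]].
have [es [pes E1]] := one_sum_primitive.
have [e ees aey] : exists2 e, e \in es & a * (e * y) <> 0.
  apply: contrapT => no; apply: ay0.
  rewrite -[y]mul1r E1 big_distrl big_distrr /= big_seq big1 // => e ees.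
  by apply: contrapT => ey; apply: no; exists e.
have pe := pes _ ees; have ee := primitive_idem pe.
pose x := e * y; have Kx : K x by rewrite /x -regularZ; apply: submoduleZ.
have ex : e * x = x by rewrite /x mulrA ee.
(* The annihilator of [x] is a left ideal. If it contained all products [b1 * b2], it would contain
   [P (n.+1 + n.+1) = P n.+1], and so [a]. *)
have [b1 [b2 [nb1 nb2 b12]]] : exists b1 b2,
    [/\ radical_power n.+1 b1, radical_power n.+1 b2 & b1 * (b2 * x) <> 0].
  apply: contrapT => no.
  pose N : set (A^o : lmodType A) := [set z | z * x = 0].
  suff: P (n.+1 + n.+1)%N `<=` N.
    rewrite Pn; last by rewrite addSn leqW // leq_addr.
    rewrite -(Pn n.+1) // => /(_ a) Na; apply: aey.
    by apply: Na; apply: spanset_sub.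
  apply: spanset_min.
    apply/submoduleP; split=> [|d z z']; rewrite /N /= ?mul0r //.
    by rewrite mulrDl regularZ -mulrA => -> ->; rewrite mulr0 addr0.
  move=> _ /radical_powerM[b1 [b2 [nb1 nb2 ->]]]; apply: contrapT.
  by rewrite /N /= -mulrA => b12; apply: no; exists b1, b2.
pose K' : set (A^o : lmodType A) := [set w | exists2 z, P n.+1 z & w = z * x].
have sK' : submodule K'.
  apply/submoduleP; split; first by exists 0; [apply: submodule0|rewrite mul0r].
  move=> d _ _ [z Pz ->] [z' Pz' ->]; exists (d * z + z').
    by have /submoduleP[_] := sP n.+1; apply.
  by rewrite mulrDl regularZ mulrA.
have K'K : K' `<=` K by move=> _ [z _ ->]; rewrite -regularZ; apply: submoduleZ.
have [K'E|K'neK] := pselect (K' = K); last first.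
  apply: (IH K' sK' K'K K'neK); exists b1, (b2 * x); split=> //.
  by exists b2 => //; apply: spanset_sub.
move: Kx; rewrite -K'E => -[z Pz xE].
have Jz : radical z by apply: PJ.
have xE' : x = e * z * e * x by rewrite -[LHS]ex {1}xE -!mulrA ex.
have [||[k zk]|[c cE]] := @primitive_local e (e * z * e) pe.
- by rewrite !mulrA ee.
- by rewrite -!mulrA ee.
- apply: aey; rewrite -/x; suff -> : x = 0 by rewrite mulr0.
  have: x = (e * z * e) ^+ k * x.
    by elim: (k) => [|i IHi]; rewrite ?expr0 ?mul1r // exprSr -mulrA -xE' -IHi.
  by rewrite zk mul0r.
by apply: (Jz e pe); exists (c * e); rewrite -[RHS]cE !mulrA.
Qed.

End Serial.
End Idempotents.

(** * Finite generation and finite length *)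

Section FiniteGeneration.
Variables (A : pzRingType) (M : lmodType A).
Implicit Types (U V : set M) (x y : M) (s : seq M).

Definition gens s : set M := foldr (fun x V => sumset (cyclic x) V) [set 0] s.

Lemma submodule_gens s : submodule (gens s).
Proof.
elim: s => [|x s IH]; first exact: submodule_set0.
by apply: submodule_sumset => //; apply: submodule_cyclic.
Qed.

Lemma mem_gens s x : x \in s -> gens s x.
Proof.
elim: s => //= y s IH; rewrite inE => /orP[/eqP->|/IH sx].
  apply: sumset_subl; [exact: (submodule0 (submodule_gens s))|exact: cyclic_id].
by apply: sumset_subr => //; apply: (submodule0 (submodule_cyclic y)).
Qed.

Lemma gensP s x : gens s x -> exists c : nat -> A, x = \sum_(i < size s) c i *: s`_i.
Proof.
elim: s x => [_ ->|y s IH _ [_ [a ->] [v /IH[c ->] ->]]] /=.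
  by exists (fun=> 0); rewrite big_ord0.
by exists (fun i => if i is j.+1 then c j else a); rewrite big_ord_recl.
Qed.

Lemma fin_gen_gens s : gens s = setT -> fin_gen M.
Proof.
move=> sT; exists (size s), (fun i => s`_i) => x.
by have [|c ->] := @gensP s x; [rewrite sT|exists c].
Qed.

(** Finite length, encoded by any strictly monotone function on the submodules of [V]; it need not
    be the actual length. *)
Definition length_fun V (l : set M -> nat) : Prop :=
  forall U U', submodule U -> submodule U' -> U `<=` U' -> U' `<=` V -> ~ U' `<=` U ->
  (l U < l U')%N.

Lemma length_fun_le V l U U' : length_fun V l ->
  submodule U -> submodule U' -> U `<=` U' -> U' `<=` V -> (l U <= l U')%N.
Proof.
move=> lP sU sU' UU' U'V; have [U'U|nU'U] := pselect (U' `<=` U).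
  by rewrite (_ : U = U') //; apply/seteqP.
by apply: ltnW; apply: lP.
Qed.

(** If no finite list generated [U], adding elements one at a time would give submodules of [U] of
    arbitrarily large [l], beyond [l U]. *)
Lemma submodule_fin_gen l U : length_fun setT l -> submodule U -> exists s, U = gens s.
Proof.
move=> lP sU; apply: contrapT => no.
have sub n : exists s, gens s `<=` U /\ (n <= l (gens s))%N.
  elim: n => [|n [s [sU' ns]]].
    by exists [::]; split=> // x ->; apply: submodule0.
  have [x [Ux nsx]] : exists x, U x /\ ~ gens s x.
    apply: contrapT => nox; apply: no; exists s; apply/seteqP; split=> // x Ux.
    by apply: contrapT => nsx; apply: nox; exists x.
  exists (x :: s); split.
    by apply: sumset_min => //; apply: cyclic_min.
  apply: leq_ltn_trans ns _; apply: lP => //; try exact: submodule_gens.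
    apply: sumset_subr; exact: (submodule0 (submodule_cyclic x)).
  by move=> /(_ x) H; apply/nsx/H/mem_gens; rewrite inE eqxx.
have [s [sU' ls]] := sub (l U).+1.
have := length_fun_le lP (submodule_gens s) sU sU' (@subsetT _ U).
by rewrite leqNgt ls.
Qed.

End FiniteGeneration.

Section Length.
Variable A : pzRingType.
Hypothesis artA : artinian (A^o : lmodType A).
Hypothesis luni : forall e : A, primitive e -> left_uniserial e.

(** If no [r] generates [I], some [h * j] in [I] is not a multiple of [r]; by uniseriality
    [r = a * (h * j)], and [a] is in the radical, since otherwise it could be inverted. Iterating
    from [r0 <> 0] writes [r0] as a multiple of an element of each radical power, against
    nilpotency. *)
Lemma left_uniserial_principal (e : A) (I : set (A^o : lmodType A)) :
  primitive e -> submodule I -> (forall a, I a -> a * e = a) ->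
  exists (r g : A), [/\ primitive g, I r, g * r = r &
    forall a : A, I a -> exists c : A, a = c * r].
Proof.
move=> pe sI Ie; have [es [pes E1]] := one_sum_primitive artA.
have split1 (a : A) : a = \sum_(g <- es) g * a by rewrite -mulr_suml -E1 mul1r.
apply: contrapT => no.
have nogen r g : primitive g -> I r -> g * r = r ->
    exists i h, [/\ h \in es, I (h * i) & ~ exists c, h * i = c * r].
  move=> pg Ir gr; apply: contrapT => noi; apply: no; exists r, g; split=> // a Ia.
  have /boolp.choice[c cE] : forall h, exists c, h \in es -> h * a = c * r.
    move=> h.
    have [[c cE]|noc] := pselect (exists c, h * a = c * r); first by exists c.
    exists 0 => hes; case: noi; exists a, h; split=> //.
    by rewrite -regularZ; apply: submoduleZ.
  exists (\sum_(h <- es) c h); rewrite [LHS]split1 mulr_suml.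
  by rewrite big_seq [RHS]big_seq; apply: eq_bigr => h /cE.
have [i [h0 [h0es Ihi nhi]]] := nogen 0 e pe (submodule0 sI) (mulr0 e).
pose r0 := h0 * i; have r00 : r0 <> 0 by move=> r00; apply: nhi; exists 0; rewrite mul0r.
have h0h0 := primitive_idem (pes _ h0es).
have [N JN] := radical_nilpotent artA luni.
suff [b [r [g [_ _ _ /JN b0 E]]]] : exists b r g, [/\ primitive g, I r, g * r = r,
    radical_power N b & b * r = r0].
  by apply: r00; rewrite -E b0 mul0r.
elim: (N) => [|n [b [r [g [pg Ir gr nb br]]]]].
  exists 1, r0, h0; split; rewrite ?mul1r //; first exact: pes.
  by rewrite /r0 mulrA h0h0.
have gg := primitive_idem pg.
have [j [h [hes Ihj nhj]]] := nogen r g pg Ir gr.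
have ph := pes _ hes; have hh := primitive_idem ph.
have [//|[c rE]] := luni pe (Ie _ Ihj) (Ie _ Ir).
pose a := g * c * h.
have ar : a * (h * j) = r by rewrite /a -!mulrA (mulrA h h) hh -rE gr.
have ga : g * a = a by rewrite /a !mulrA gg.
have ah : a * h = a by rewrite /a -!mulrA hh.
have [Ja|nJa] := pselect (radical a).
  exists (b * a), (h * j), h; split=> //; first by rewrite mulrA hh.
    exact: radical_powerS.
  by rewrite -mulrA ar.
have [u [_ _ ua _]] := nonradical_inv pg ph ga ah nJa.
by case: nhj; exists u; rewrite -ar mulrA ua mulrA hh.
Qed.

(** The Loewy length is strictly monotone on the left ideals inside [A e]. *)
Lemma length_fun_ideal (e : A) : primitive e ->
  exists l, @length_fun A (A^o : lmodType A) [set a | a * e = a] l.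
Proof.
move=> pe; have [N JN] := radical_nilpotent artA luni.
pose kills (I : set A) n := `[< forall i b, I i -> radical_power n b -> b * i = 0 >].
have ex I : exists n, kills I n.
  by exists N; apply/asboolP => i b _ /JN ->; rewrite mul0r.
exists (fun I => ex_minn (ex I)) => I I' sI sI' II' I'e nI'I.
case: ex_minnP => m _ minm; case: ex_minnP => -[|n] /asboolP kn _.
  case: nI'I => a /kn /(_ (erefl : radical_power 0 1)); rewrite mul1r => ->.
  exact: (submodule0 sI).
rewrite ltnS; apply: minm; apply/asboolP => i b Ii nb.
have [r [g [pg Ir gr gen]]] := left_uniserial_principal pe sI (fun a Ia => I'e a (II' a Ia)).
have [r' [g' [pg' Ir' gr' gen']]] := left_uniserial_principal pe sI' I'e.
have gg := primitive_idem pg; have gg' := primitive_idem pg'.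
have [d rE] := gen' r (II' _ Ir).
(* The generators satisfy [r = a * r']. If [a] is in the radical, then [J ^ n I] lies in
   [J ^ n.+1 I' = 0]; if not, [a] is invertible and [I = I']. *)
pose a := g * d * g'.
have ar : a * r' = r by rewrite /a -!mulrA gr' -rE gr.
have [Ja|nJa] := pselect (radical a).
  have [c ->] := gen i Ii.
  rewrite -ar mulrA mulrA; apply: kn => //; rewrite -mulrA.
  exact: radical_powerS nb (radicalMl Ja).
have [||u [_ _ ua _]] := nonradical_inv pg pg' _ _ nJa.
- by rewrite /a !mulrA gg.
- by rewrite /a -!mulrA gg'.
case: nI'I => x /gen'[c ->]; rewrite -gr' -ua -(mulrA u) ar mulrA -regularZ.
exact: submoduleZ.
Qed.

Section Modules.
Variable M : lmodType A.

(** Additivity along [V]: to [U] is attached the length of [U] cut with [V] plus that of its image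
    modulo [V], the latter pulled back along [a |-> a *: x] to the left ideal [I U] of [A e]. *)
Lemma length_fun_sumset (e : A) (x : M) (V : set M) : primitive e -> e *: x = x ->
  submodule V -> (exists l, length_fun V l) ->
  exists l, length_fun (sumset (cyclic x) V) l.
Proof.
move=> pe ex sV [l lP]; have [m mP] := length_fun_ideal pe.
pose I U : set (A^o : lmodType A) := [set a | a * e = a /\ sumset U V (a *: x)].
have sI U : submodule U -> submodule (I U).
  move=> sU; apply/submoduleP; split.
    split; first exact: mul0r.
    by rewrite scale0r; apply: (submodule0 (submodule_sumset sU sV)).
  move=> a b c [be Ub] [ce Uc]; split.
    by rewrite regularZ mulrDl -mulrA be ce.
  rewrite scalerDl regularZ -scalerA.
  by apply: submoduleD; rewrite //; try apply: submoduleZ => //; apply: submodule_sumset.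
exists (fun U => l (U `&` V) + m (I U))%N => U U' sU sU' UU' U'W nU'U.
have UV : U `&` V `<=` U' `&` V by move=> y [/UU'].
have II : I U `<=` I U' by move=> a [ae [u /UU' Uu [v Vv E]]]; split=> //; exists u => //; exists v.
have Ie W : I W `<=` [set a | a * e = a] by move=> a [].
have lle : (l (U `&` V) <= l (U' `&` V))%N.
  by apply: length_fun_le lP _ _ _ _ => //; apply: submoduleI.
have mle : (m (I U) <= m (I U'))%N.
  by apply: length_fun_le mP _ _ _ _ => //; apply: sI.
have [VU|nVU] := pselect (U' `&` V `<=` U `&` V); last first.
  by rewrite -addSn leq_add //; apply: lP => //; apply: submoduleI.
have [IU|nIU] := pselect (I U' `<=` I U); last first.
  by rewrite -addnS leq_add //; apply: mP => //; apply: sI.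
case: nU'U => y U'y; have [_ [a ->] [v Vv yE]] := U'W y U'y.
have [|_ [u Uu [w Vw aE]]] := IU (a * e).
  split; first by rewrite -mulrA (primitive_idem pe).
  rewrite -scalerA ex; exists y => //; exists (- v); first exact: submoduleN.
  by rewrite yE addrK.
rewrite -scalerA ex in aE.
have yuE : y - u = w + v by rewrite yE aE -(addrA u) [u + _]addrC addrK.
rewrite -(subrK u y); apply: submoduleD => //.
have /VU[] // : (U' `&` V) (y - u).
split; first by apply: submoduleB => //; apply: UU'.
by rewrite yuE; apply: submoduleD.
Qed.

(** Each generator is cut into pieces [e *: x i] with [e] primitive, which are then added one by one
    with [length_fun_sumset]. *)
Lemma fin_gen_length : fin_gen M -> exists l, @length_fun A M setT l.
Proof.
move=> [n [x xP]]; have [es [pes E1]] := one_sum_primitive artA.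
pose s := [seq e *: x i | e <- es, i <- enum 'I_n].
have -> : setT = gens s.
  apply/seteqP; split=> // y _; have [c ->] := xP y.
  apply: submodule_sum => [|i _]; first exact: submodule_gens.
  apply: submoduleZ; first exact: submodule_gens.
  rewrite -[x i]scale1r E1 scaler_suml big_seq.
  apply: submodule_sum => [|e ees]; first exact: submodule_gens.
  by apply: mem_gens; apply: allpairs_f => //; rewrite mem_enum.
have : forall y, y \in s -> exists2 e, primitive e & e *: y = y.
  move=> _ /allpairsP[[e i] /= [ees _ ->]]; exists e; first exact: pes.
  by rewrite scalerA primitive_idem //; apply: pes.
elim: s => [_|y s IH sP].
  exists (fun=> 0%N) => U U' sU sU' UU' U'0; case=> z /U'0 ->; exact: submodule0.
have [|e pe ey] := sP y; first by rewrite inE eqxx.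
apply: (length_fun_sumset pe ey); first exact: submodule_gens.
by apply: IH => z zs; apply: sP; rewrite inE zs orbT.
Qed.

End Modules.
End Length.

(** * Isomorphisms of subquotients as linear relations *)

Section LinearRelations.
Variable A : pzRingType.

(** Linear relations represent maps between subquotients, so that these can be composed, inverted
    and restricted without forming quotient modules. *)
Definition linear_rel (M N : lmodType A) (G : M -> N -> Prop) : Prop :=
  G 0 0 /\ forall a x x' y y', G x y -> G x' y' -> G (a *: x + x') (a *: y + y').

(** The graph [G] induces an isomorphism from [V / U] to [V' / U']. *)
Definition subquo_graph (M N : lmodType A) (U V : set M) (U' V' : set N) G : Prop :=
  linear_rel G /\ [/\ forall x, V x <-> exists y, G x y,
    forall y, V' y <-> exists x, G x y, forall x, U x <-> G x 0 & forall y, U' y <-> G 0 y].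

Definition subquo_iso (M N : lmodType A) (U V : set M) (U' V' : set N) : Prop :=
  exists G, subquo_graph U V U' V' G.

Section Facts.
Variables (M N : lmodType A) (G : M -> N -> Prop).
Hypothesis linG : linear_rel G.

Lemma linear_rel0 : G 0 0. Proof. by case: linG. Qed.

Lemma linear_relZ a x y : G x y -> G (a *: x) (a *: y).
Proof.
by case: linG => G0 GD Gxy; rewrite -[a *: x]addr0 -[a *: y]addr0; apply: GD.
Qed.

Lemma linear_relD x y x' y' : G x y -> G x' y' -> G (x + x') (y + y').
Proof. by case: linG => _ GD Gxy; rewrite -[x]scale1r -[y]scale1r; apply: GD. Qed.

Lemma linear_relB x y x' y' : G x y -> G x' y' -> G (x - x') (y - y').
Proof.
move=> Gxy /(linear_relZ (-1)); rewrite !scaleN1r; exact: linear_relD.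
Qed.

Lemma linear_rel_function : (forall x, exists y, G x y) -> (forall y, G 0 y -> y = 0) ->
  exists f : {linear M -> N}, forall x y, G x y <-> y = f x.
Proof.
move=> /boolp.choice[f Gf] G0.
have fP x y : G x y <-> y = f x.
  split=> [Gxy|->//]; apply/eqP; rewrite -subr_eq0; apply/eqP/G0.
  by rewrite -(subrr x); apply: linear_relB.
have lf : linear f.
  by move=> a x y; apply/esym/fP; case: linG => _; apply.
pose fM := GRing.isLinear.Build _ _ _ _ f lf.
pose g : {linear M -> N} := HB.pack f fM.
by exists g.
Qed.

End Facts.

Lemma subquo_iso_refl (M : lmodType A) (U V : set M) :
  submodule U -> submodule V -> U `<=` V -> subquo_iso U V U V.
Proof.
move=> sU sV UV; exists (fun x y => [/\ V x, V y & U (x - y)]); split.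
  split=> [|a x x' y y' [Vx Vy Uxy] [Vx' Vy' Uxy']].
    by rewrite subr0; split; apply: submodule0.
  split; try by apply: submoduleD => //; apply: submoduleZ.
  by rewrite opprD addrACA -scalerBr; apply: submoduleD => //; apply: submoduleZ.
split=> x.
- split=> [Vx|[y []//]]; exists x; split=> //; rewrite subrr; exact: submodule0.
- split=> [Vx|[y []//]]; exists x; split=> //; rewrite subrr; exact: submodule0.
- by rewrite subr0; split=> [Ux|[]//]; split=> //; [apply: UV|apply: submodule0].
- rewrite sub0r; split=> [Ux|[_ _ /(submoduleN sU)]]; last by rewrite opprK.
  by split; [apply: submodule0|apply: UV|apply: submoduleN].
Qed.

Lemma subquo_graph_sym (M N : lmodType A) (U V : set M) (U' V' : set N) G :
  subquo_graph U V U' V' G -> subquo_graph U' V' U V (fun y x => G x y).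
Proof. by move=> [[G0 GD] [GV GV' GU GU']]; split; split=> // *; apply: GD. Qed.

Lemma subquo_iso_sym (M N : lmodType A) (U V : set M) (U' V' : set N) :
  subquo_iso U V U' V' -> subquo_iso U' V' U V.
Proof. by move=> [G /subquo_graph_sym GP]; exists (fun y x => G x y). Qed.

Lemma subquo_iso_trans (M N P : lmodType A) (U V : set M) (U' V' : set N) (U'' V'' : set P) :
  subquo_iso U V U' V' -> subquo_iso U' V' U'' V'' -> subquo_iso U V U'' V''.
Proof.
move=> [G [linG [GV GV' GU GU']]] [H [linH [HV HV' HU HU']]].
exists (fun x z => exists2 y, G x y & H y z); split.
  split; first by exists 0; [case: linG|case: linH].
  move=> a x x' z z' [y Gxy Hyz] [y' Gxy' Hyz'].
  by exists (a *: y + y'); [case: linG => _; apply|case: linH => _; apply].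
split=> x.
- split=> [/GV[y Gxy]|[z [y Gxy _]]]; last by apply/GV; exists y.
  have /HV[z Hyz] : V' y by apply/GV'; exists x.
  by exists z, y.
- split=> [/HV'[y Hyx]|[z [y _ Hyx]]]; last by apply/HV'; exists y.
  have /GV'[z Gzy] : V' y by apply/HV; exists x.
  by exists z, y.
- split=> [/GU Gx0|[y Gxy /HU/GU' G0y]]; first by exists 0 => //; case: linH.
  apply/GU; move: (linear_relB linG Gxy G0y); by rewrite subr0 subrr.
- split=> [/HU' H0x|[y /GU'/HU Hy0 Hyx]]; first by exists 0 => //; case: linG.
  apply/HU'; move: (linear_relB linH Hyx Hy0); by rewrite subr0 subrr.
Qed.

Section Graph.
Variables (M N : lmodType A) (U V : set M) (U' V' : set N) (G : M -> N -> Prop).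
Hypothesis GP : subquo_graph U V U' V' G.

Lemma subquo_graph_submodule : [/\ submodule U, submodule V & U `<=` V].
Proof.
have [linG [GV GV' GU GU']] := GP; split.
- apply/submoduleP; split=> [|a x y /GU Gx /GU Gy]; first by apply/GU; case: linG.
  by apply/GU; have := linG.2 a _ _ _ _ Gx Gy; rewrite scaler0 addr0.
- apply/submoduleP; split=> [|a x y /GV[x' Gx] /GV[y' Gy]].
    by apply/GV; exists 0; case: linG.
  by apply/GV; exists (a *: x' + y'); apply: linG.2.
- by move=> x /GU Gx0; apply/GV; exists 0.
Qed.

Lemma subquo_graph_unique x y y' : G x y -> G x y' -> U' (y - y').
Proof.
have [linG [GV GV' GU GU']] := GP => Gxy Gxy'; apply/GU'.
by rewrite -(subrr x); apply: linear_relB.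
Qed.

Definition graph_image (W : set M) : set N := [set y | exists2 x, W x & G x y].

Lemma submodule_graph_image W : submodule W -> submodule (graph_image W).
Proof.
have [[G0 GD] _] := GP => /submoduleP[W0 WD]; apply/submoduleP; split; first by exists 0.
by move=> a y y' [x Wx Gxy] [x' Wx' Gxy']; exists (a *: x + x'); [apply: WD|apply: GD].
Qed.

Lemma graph_image_sub W : graph_image W `<=` V'.
Proof. by have [_ [_ GV' _ _]] := GP => y [x _ Gxy]; apply/GV'; exists x. Qed.

Lemma graph_image_low : graph_image U = U'.
Proof.
have [linG [GV GV' GU GU']] := GP; apply/seteqP; split=> [y [x /GU Gx0 Gxy]|y /GU' G0y].
  by have := subquo_graph_unique Gxy Gx0; rewrite subr0.
by exists 0 => //; apply/GU; case: linG.
Qed.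

Lemma graph_image_top : graph_image V = V'.
Proof.
have [_ [GV GV' _ _]] := GP; apply/seteqP; split; first exact: graph_image_sub.
by move=> y /GV'[x Gxy]; exists x => //; apply/GV; exists y.
Qed.

Lemma graph_imageS W W' : W `<=` W' -> graph_image W `<=` graph_image W'.
Proof. by move=> WW' y [x /WW' Wx Gxy]; exists x. Qed.

Lemma subquo_graph_restrict W1 W2 : submodule W1 -> submodule W2 ->
  U `<=` W1 -> W1 `<=` W2 -> W2 `<=` V ->
  subquo_iso W1 W2 (graph_image W1) (graph_image W2).
Proof.
have [linG [GV GV' GU GU']] := GP => sW1 sW2 UW1 W12 W2V.
(* An element of [W2 / W1] is given up to [W1], so [x] may be corrected by some [w] before [G] is
   applied. *)
exists (fun x y => W2 x /\ exists2 w, W1 w & G (x - w) y); split.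
  split.
    split; first exact: submodule0.
    by exists 0; [apply: submodule0|rewrite subr0; case: linG].
  move=> a x x' y y' [Wx [w Ww Gy]] [Wx' [w' Ww' Gy']]; split.
    by apply: submoduleD => //; apply: submoduleZ.
  exists (a *: w + w'); first by apply: submoduleD => //; apply: submoduleZ.
  by rewrite opprD addrACA -scalerBr; apply: linG.2.
split=> x.
- split=> [Wx|[y []//]]; have /GV[y Gxy] := W2V x Wx.
  by exists y; split=> //; exists 0; [apply: submodule0|rewrite subr0].
- split=> [[y Wy Gyx]|[y [Wy [w Ww Gx]]]].
    by exists y; split=> //; exists 0; [apply: submodule0|rewrite subr0].
  by exists (y - w) => //; apply: submoduleB => //; apply: W12.
- split=> [Wx|[Wx [w Ww /GU Uxw]]].
    split; first exact: W12.
    by exists x => //; rewrite subrr; case: linG.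
  by rewrite -(subrK w x); apply: submoduleD => //; apply: UW1.
- split=> [[y Wy Gyx]|[_ [w Ww]]]; last first.
    by rewrite sub0r => Gx; exists (- w) => //; apply: submoduleN.
  split; first exact: submodule0.
  by exists (- y); [apply: submoduleN|rewrite opprK add0r].
Qed.

End Graph.

Lemma graph_imageK (M N : lmodType A) (U V : set M) (U' V' : set N) G W :
  subquo_graph U V U' V' G -> submodule W -> U `<=` W -> W `<=` V ->
  graph_image (fun y x => G x y) (graph_image G W) = W.
Proof.
move=> GP sW UW WV; have GP' := subquo_graph_sym GP; apply/seteqP; split.
  move=> x [y [x' Wx' Gx'y] Gxy]; rewrite -(subrK x' x); apply: submoduleD => //.
  by apply: UW; apply: (subquo_graph_unique GP' Gxy Gx'y).
have [_ [GV _ _ _]] := GP.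
by move=> x Wx; have /GV[y Gxy] := WV x Wx; exists y => //; exists x.
Qed.

Lemma subquo_iso_submodule (M N : lmodType A) (U V : set M) (U' V' : set N) :
  subquo_iso U V U' V' -> [/\ submodule U, submodule V & U `<=` V].
Proof. by move=> [G GP]; apply: subquo_graph_submodule GP. Qed.

(** The second isomorphism theorem, by the relation of congruence modulo [W]. *)
Lemma subquo_iso_sum_cap (M : lmodType A) (V W : set M) :
  submodule V -> submodule W -> subquo_iso (V `&` W) V W (sumset V W).
Proof.
move=> sV sW; exists (fun x y => V x /\ W (y - x)); split.
  split; first by rewrite subr0; split; apply: submodule0.
  move=> a x x' y y' [Vx Wy] [Vx' Wy']; split.
    by apply: submoduleD => //; apply: submoduleZ.
  by rewrite opprD addrACA -scalerBr; apply: submoduleD => //; apply: submoduleZ.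
split=> x.
- by split=> [Vx|[y []//]]; exists x; rewrite subrr; split=> //; apply: submodule0.
- split=> [[v Vv [w Ww ->]]|[v [Vv Wx]]]; first by exists v; rewrite addrC addKr.
  by exists v => //; exists (x - v) => //; rewrite addrC subrK.
- rewrite sub0r; split=> [[Vx Wx]|[Vx /(submoduleN sW)]]; last by rewrite opprK.
  by split=> //; apply: submoduleN.
- by rewrite subr0; split=> [Wx|[]//]; split=> //; apply: submodule0.
Qed.

(** The carrier is the set of elements of [V] chosen as representatives of their coset modulo [U].
    Congruent elements have equal cosets as sets, so [xget] picks the same representative for
    both. *)
Lemma subquotient_module (M : lmodType A) (U V : set M) :
  submodule U -> submodule V -> U `<=` V ->
  exists Q : lmodType A, subquo_iso U V [set 0] [set: Q].
Proof.
move=> sU sV UV.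
pose rep x := xget (0 : M) [set y | U (x - y)].
have repP x : U (x - rep x).
  by rewrite /rep; case: xgetP => // /(_ x) []; rewrite /= subrr; apply: submodule0.
have rep_eq x y : U (x - y) -> rep x = rep y.
  move=> Uxy; congr (xget 0 _); apply/seteqP; split=> z /= Uz.
    by rewrite -(subrK x y) -addrA -opprB; apply: submoduleD => //; apply: submoduleN.
  by rewrite -(subrK y x) -addrA; apply: submoduleD.
have Vrep x : V x -> V (rep x).
  by move=> Vx; rewrite -(subKr x (rep x)); apply: submoduleB => //; apply: UV.
have repr_rep x : rep (rep x) = rep x.
  by apply: rep_eq; rewrite -opprB; apply: submoduleN.
have repD x y : rep (rep x + y) = rep (x + y).
  by apply: rep_eq; rewrite opprD addrACA subrr addr0 -opprB; apply: submoduleN.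
have repZ a x : rep (a *: rep x) = rep (a *: x).
  by apply: rep_eq; rewrite -scalerBr; apply: submoduleZ; rewrite // -opprB; apply: submoduleN.
pose T := {x : M | `[< V x /\ rep x = x >]}.
have mkP x : V x -> `[< V (rep x) /\ rep (rep x) = rep x >].
  by move=> Vx; apply/asboolP; split=> //; apply: Vrep.
pose mk x (Vx : V x) : T := exist _ (rep x) (mkP x Vx).
have TV (p : T) : V (sval p) by case: p => x /= /asboolP[].
have repT (p : T) : rep (sval p) = sval p by case: p => x /= /asboolP[].
pose add (p q : T) := mk _ (submoduleD sV (TV p) (TV q)).
pose opp (p : T) := mk _ (submoduleN sV (TV p)).
pose zero : T := mk 0 (submodule0 sV).
pose scale a (p : T) := mk _ (submoduleZ a sV (TV p)).
have addA : associative add.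
  by move=> p q r; apply: val_inj; rewrite /= repD addrC repD addrC addrA.
have addC : commutative add.
  by move=> p q; apply: val_inj; rewrite /= addrC.
have add0 : left_id zero add.
  by move=> p; apply: val_inj; rewrite /= repD add0r repT.
have addN : left_inverse zero opp add.
  by move=> p; apply: val_inj; rewrite /= repD addNr.
pose QZ := GRing.isZmodule.Build T addA addC add0 addN.
pose Z : zmodType := HB.pack T QZ.
have scaleA a b (p : Z) : scale a (scale b p) = scale (a * b) p.
  by apply: val_inj; rewrite /= repZ scalerA.
have scale1 : left_id 1 (scale : A -> Z -> Z).
  by move=> p; apply: val_inj; rewrite /= scale1r repT.
have scaleDr : right_distributive (scale : A -> Z -> Z) +%R.
  move=> a p q; change (scale a (add p q) = add (scale a p) (scale a q)).
  by apply: val_inj; rewrite /= repZ repD [_ + rep _]addrC repD scalerDr addrC.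
have scaleDl (p : Z) : {morph (scale : A -> Z -> Z)^~ p : a b / a + b}.
  move=> a b; change (scale (a + b) p = add (scale a p) (scale b p)).
  by apply: val_inj; rewrite /= repD [_ + rep _]addrC repD scalerDl addrC.
pose QL := GRing.Zmodule_isLmodule.Build A Z scaleA scale1 scaleDr scaleDl.
pose Q : lmodType A := HB.pack T QZ QL.
have U0 : U (rep 0) by rewrite -[rep 0]opprK -[- rep 0]sub0r; apply: submoduleN.
exists Q, (fun x (q : T) => V x /\ U (x - sval q)); split.
  split; first by split; [apply: submodule0|apply: repP].
  move=> a x x' p q [Vx Ux] [Vx' Ux']; split.
    by apply: submoduleD => //; apply: submoduleZ.
  change (U (a *: x + x' - sval (add (scale a p) q))); rewrite /= repD.
  rewrite -(subrK (a *: sval p + sval q) (a *: x + x')) -addrA.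
  apply: submoduleD => //; rewrite opprD addrACA -scalerBr.
  by apply: submoduleD => //; apply: submoduleZ.
split=> x.
- by split=> [Vx|[q []//]]; exists (mk x Vx).
- by split=> // _; exists (sval x); rewrite subrr; split=> //; apply: submodule0.
- change (U x <-> V x /\ U (x - rep 0)); split=> [Ux|[Vx Uxr]].
    by split; [apply: UV|apply: submoduleB].
  by rewrite -(subrK (rep 0) x); apply: submoduleD.
- split=> [->|[_ Ux]]; first by split; [apply: submodule0|apply: repP].
  by apply: val_inj; rewrite /= -[sval x]repT -(rep_eq _ _ Ux).
Qed.

End LinearRelations.

(** * Artin algebras and Nakayama algebras *)

(** Induction on a list of generators: after adding [x], the chain is stationary as soon as both its
    traces on the old generators and the ideals of the [r] with [r *: x] in [U k + gens s] are. *)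
Lemma artinian_fin_gen (R : pzRingType) (M : lmodType R) :
  artinian (R^o : lmodType R) -> fin_gen M -> artinian M.
Proof.
move=> artR [n [e eP]] U sU Udec.
have UM i j : (i <= j)%N -> U j `<=` U i.
  move=> /subnK <-; elim: (j - i)%N => [//|k IH] x /Udec; exact: IH.
have stab s : exists n, forall m, (n <= m)%N -> U n `&` gens s `<=` U m.
  elim: s => [|x s [N1 IH]].
    by exists 0%N => m _ _ [_ ->]; apply: submodule0.
  pose I k : set (R^o : lmodType R) := [set r | sumset (U k) (gens s) (r *: x)].
  have ss k : submodule (sumset (U k) (gens s)).
    by apply: submodule_sumset => //; apply: submodule_gens.
  have [||N2 IN2] := artR I.
  - move=> k; have /submoduleP[_ SD] := ss k; apply/submoduleP; split.
      by rewrite /I /= scale0r; apply: submodule0.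
    by move=> a b c; rewrite /I /= scalerDl regularZ -scalerA; apply: SD.
  - by move=> k r [u /Udec Uu [v sv E]]; exists u => //; exists v.
  exists (maxn N1 N2) => m Nm y [Uy [_ [r ->] [v sv yE]]].
  have [N1m N2m] : (N1 <= m)%N /\ (N2 <= m)%N by move: Nm; rewrite geq_max => /andP[].
  have : I (maxn N1 N2) r.
    exists y => //; exists (- v); first by apply: submoduleN => //; apply: submodule_gens.
    by rewrite yE addrK.
  rewrite IN2 ?leq_maxr // -(IN2 m) // => -[u Uu [w sw E]].
  rewrite -(subrK u y); apply: submoduleD => //; apply: (IH m N1m); split.
    apply: submoduleB => //; first exact: UM (leq_maxl _ _) _ Uy.
    by apply: UM Uu.
  rewrite yE E -(addrA u) [u + _]addrC addrK.
  by apply: submoduleD => //; apply: submodule_gens.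
have [N NP] := stab [seq e i | i <- enum 'I_n].
exists N => m Nm; apply/seteqP; split; first exact: UM.
move=> x Ux; apply: NP => //; split=> //; have [c ->] := eP x.
apply: submodule_sum => [|i _]; first exact: submodule_gens.
apply: submoduleZ; first exact: submodule_gens.
by apply: mem_gens; apply: map_f; rewrite mem_enum.
Qed.

(** Right ideals of [L] are [R]-submodules because [iota] is central, and [L] is finitely generated
    over the artinian ring [R]. *)
Lemma artin_algebra_artinian (R : comPzRingType) (L : pzRingType)
    (iota : {rmorphism R -> L}) :
  artin_algebra iota -> artinian (L^c^o : lmodType L^c).
Proof.
move=> [artR central [n [e eP]]].
pose scale (r : R) (x : L) := iota r * x.
have scaleA a b (x : L) : scale a (scale b x) = scale (a * b) x.
  by rewrite /scale rmorphM mulrA.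
have scale1 : left_id 1 scale by move=> x; rewrite /scale rmorph1 mul1r.
have scaleDr : right_distributive scale +%R by move=> a x y; rewrite /scale mulrDr.
have scaleDl (x : L) : {morph scale^~ x : a b / a + b}.
  by move=> a b; rewrite /scale rmorphD mulrDl.
pose LR := GRing.Zmodule_isLmodule.Build R L scaleA scale1 scaleDr scaleDl.
pose LM : lmodType R := HB.pack (GRing.PzRing.sort L) LR.
have fgL : fin_gen LM by exists n, e.
move=> U sU Udec; apply: (artinian_fin_gen artR fgL) => // k.
apply/submoduleP; split=> [|a x y Ux Uy]; first exact: (submodule0 (sU k)).
change (U k (iota a * x + y)); rewrite central.
by have /submoduleP[_ UD] := sU k; apply: (UD (iota a : L^c)).
Qed.

(** The left ideal [A e] is realized as a module [Q] generated by the image [q0] of [e]. It is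
    projective and indecomposable, so the hypothesis makes it uniserial, and inclusions of its
    cyclic submodules are divisibilities in [A]. *)
Lemma primitive_left_uniserial (A : pzRingType) (e : A) :
  proj_indec_uniserial A -> primitive e -> left_uniserial e.
Proof.
move=> uni pe; have [e0 ee prim] := pe.
pose V : set (A^o : lmodType A) := [set a | a * e = a].
have sV : submodule V.
  apply/submoduleP; split=> [|a x y Vx Vy]; first by rewrite /V /= mul0r.
  by rewrite /V /= mulrDl regularZ -mulrA Vx Vy.
have [|Q [G GP]] := subquotient_module (@submodule_set0 A (A^o : lmodType A)) sV.
  by move=> _ ->; apply: submodule0.
have [linG [GV GV' GU GU']] := GP.
have [q0 Gq0] : exists q0, G e q0 by apply/GV.
have Gq a : a * e = a -> G a (a *: q0).
  by move=> ae; have := linear_relZ linG a Gq0; rewrite regularZ ae.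
have Ginj (a b : A) q : G a q -> G b q -> a = b.
  move=> Ga Gb; apply/eqP; rewrite -subr_eq0; apply/eqP.
  by have := subquo_graph_unique (subquo_graph_sym GP) Ga Gb.
have Gfun (a : A) q : G a q -> a * e = a /\ q = a *: q0.
  move=> Gaq; have Va : V a by apply/GV; exists q.
  split=> //; apply/eqP; rewrite -subr_eq0; apply/eqP.
  exact: (subquo_graph_unique GP Gaq (Gq a Va)).
have Gex q : exists2 a : A, a * e = a & q = a *: q0.
  by have /GV'[a /Gfun[ae ->]] : [set: Q] q by []; exists a.
have fgQ : fin_gen Q.
  by exists 1%N, (fun=> q0) => q; have [a _ ->] := Gex q; exists (fun=> a); rewrite big_ord1.
have projQ : projective Q.
  move=> M N g f gsurj.
  have [m _ gm] : range g (f q0) by rewrite gsurj.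
  (* The lift sends [a *: q0] to [a *: m]; taking [a] in [A e], where [q] determines it, makes this
     well defined. *)
  pose H (q : Q) m' := exists2 a : A, G a q & m' = a *: m.
  have linH : linear_rel H.
    split; first by exists 0; [case: linG|rewrite scale0r].
    move=> c x x' _ _ [a Ga ->] [b Gb ->]; exists (c *: (a : A^o) + b); first exact: linG.2.
    by rewrite scalerDl scalerA.
  have [q|m' [a Ga ->]|h hP] := linear_rel_function linH.
  - by have /GV'[a Ga] : [set: Q] q by []; exists (a *: m), a.
  - by rewrite (Ginj a 0 0 Ga) ?scale0r //; case: linG.
  exists h => q; have /hP[a Ga ->] : h q = h q by [].
  by have [_ ->] := Gfun _ _ Ga; rewrite !linearZ gm.
have indQ : indecomposable Q.
  split.
    move=> Q0; apply: e0; apply: (Ginj e 0 0); first by rewrite -(Q0 q0).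
    by case: linG.
  move=> U W sU sW UW sum.
  have [u0 Uu0 [w0 Ww0 q0E]] := sum q0.
  have [a ae aE] := Gex u0; pose u := e *: u0; pose w := e *: w0.
  have Uu : U u by apply: submoduleZ.
  have Ww : W w by apply: submoduleZ.
  have eq0 : e *: q0 = q0 by have [_ <-] := Gfun _ _ Gq0.
  have q0E' : q0 = u + w by rewrite -scalerDr -q0E.
  (* The component of [e] in [U]: an idempotent of [e A e], hence [0] or [e], which puts [q0] in [W]
     or in [U]. *)
  pose b := e * a.
  have uE : u = b *: q0 by rewrite /u aE scalerA.
  have be : b * e = b by rewrite /b -mulrA ae.
  have eb : e * b = b by rewrite /b mulrA ee.
  have bu : b *: u = u.
    apply/eqP; rewrite -subr_eq0; apply/eqP.
    suff : (U `&` W) (b *: u - u) by rewrite UW.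
    split; first by apply: submoduleB => //; apply: submoduleZ.
    rewrite {2}uE q0E' scalerDr opprD addrA subrr sub0r.
    by apply: submoduleN => //; apply: submoduleZ.
  have Gb : G b u by rewrite uE; apply: Gq.
  have bb : b * b = b.
    by apply: (Ginj _ _ u) => //; rewrite -[X in G _ X]bu; apply: (linear_relZ linG b Gb).
  have full (X Y : set Q) : submodule X -> Y 0 -> U `&` W = X `&` Y -> X q0 -> Y = [set 0].
    move=> sX Y0 XY Xq0; apply/seteqP; split=> [x Yx|_ ->//].
    rewrite -UW XY; split=> //; have [c _ ->] := Gex x.
    exact: submoduleZ.
  have [b0|bE] := prim b bb eb be; [left|right].
    apply: (full W U) => //; first exact: submodule0.
      by rewrite setIC.
    by rewrite q0E' uE b0 scale0r add0r.
  apply: (full U W) => //; first exact: submodule0.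
  by rewrite -eq0 -bE -uE.
move=> a b ae be.
have cyc x y : x * e = x -> y * e = y -> cyclic (x *: q0) `<=` cyclic (y *: q0) ->
    exists c, x = c * y.
  move=> xe ye /(_ _ (cyclic_id _))[c E]; exists c.
  apply: (Ginj _ _ (x *: q0)); first exact: Gq.
  by rewrite E; apply: (linear_relZ linG c (Gq _ ye)).
have := uni (FgMod fgQ) projQ indQ _ _ (submodule_cyclic (a *: q0)) (submodule_cyclic (b *: q0)).
by case=> [/cyc|/cyc]; [left|right]; auto.
Qed.

Lemma converse_primitive (L : pzRingType) (e : L) :
  primitive (e : L^c) -> primitive e.
Proof. by case=> e0 ee prim; split=> // f ff ef fe; apply: prim. Qed.

Lemma converse_left_uniserial (L : pzRingType) (e : L) :
  left_uniserial e -> right_uniserial (e : L^c).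
Proof. exact. Qed.

(** * Subquotients and cyclic direct summands over a serial ring *)

Section SerialModules.
Variable A : pzRingType.
Hypothesis artA : artinian (A^o : lmodType A).
Hypothesis luni : forall e : A, primitive e -> left_uniserial e.
Hypothesis runi : forall e : A, primitive e -> right_uniserial e.

(** The length function of [C] makes [V] finitely generated, and the images of its generators
    generate the quotient. *)
Lemma subquotient_fgmod (C : fgmod A) (U V : set C) :
  submodule U -> submodule V -> U `<=` V ->
  exists Z : fgmod A, subquo_iso U V [set 0] [set: Z].
Proof.
move=> sU sV UV; have [Q [G GP]] := subquotient_module sU sV UV.
have [l lP] := fin_gen_length artA luni (fgmod_fin_gen C).
have [s Vs] := submodule_fin_gen lP sV.
have [linG [GV GV' GU GU']] := GP.
have /boolp.choice[f fP] : forall x, exists q, V x -> G x q.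
  move=> x; have [/GV[q Gxq]|nVx] := pselect (V x); first by exists q.
  by exists 0.
have fgQ : fin_gen Q.
  apply: (@fin_gen_gens _ _ (map f s)); apply/seteqP; split=> // q _.
  have /GV'[x Gxq] : [set: Q] q by [].
  have /[!Vs]/gensP[c xE] : V x by apply/GV; exists q.
  have Gx : G x (\sum_(i < size s) c i *: f s`_i).
    rewrite xE; apply: (big_ind2 G) => [|x1 q1 x2 q2|i _].
    - exact: linear_rel0.
    - exact: linear_relD.
    - by apply: linear_relZ => //; apply: fP; rewrite Vs; apply: mem_gens; apply: mem_nth.
  have /eqP := subquo_graph_unique GP Gxq Gx; rewrite subr_eq0 => /eqP ->.
  apply: submodule_sum => [|i _]; first exact: submodule_gens.
  apply: submoduleZ; first exact: submodule_gens.
  by apply: mem_gens; apply: map_f; apply: mem_nth.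
by exists (FgMod fgQ), G.
Qed.

(** A submodule [N] maximal among those with [N `&` cyclic x = 0] is a
    complement: an element [y = f *: y] outside [cyclic x + N] would satisfy a
    relation [r *: y - s *: x \in N] generating all such relations.  One of [r]
    and [s] divides the other on the right: if [s = r * t], then [y - t *: x]
    contradicts the maximality of [N]; if [r = s * t] with [t] in the radical,
    then [s *: x] contradicts the choice of [x] with maximal Loewy length. *)
Lemma cyclic_complement (M : lmodType A) (x : M) (e : A) k :
  primitive e -> e *: x = x ->
  (exists2 b, radical_power k b & b *: x <> 0) ->
  (forall b (y : M), radical_power k.+1 b -> b *: y = 0) ->
  exists N : set M, [/\ submodule N, cyclic x `&` N = [set 0] & sumset (cyclic x) N = setT].
Proof.
move=> pe ex [b kb bx] Jk1.
pose P (N : set M) := N = set0 \/ submodule N /\ forall z, cyclic x z -> N z -> z = 0.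
have [F FP Ftot|N [PN maxN]] := @Zorn_bigcup M P.
  have [F0|] := pselect (forall N, F N -> N = set0).
    by left; apply/seteqP; split=> // y [N /F0 ->].
  move=> /existsNP[N0 /not_implyP[FN0 N0ne]].
  have F2 y z : (\bigcup_(X in F) X) y -> (\bigcup_(X in F) X) z -> exists N, [/\ F N, N y & N z].
    move=> [N1 FN1 N1y] [N2 FN2 N2z].
    by have [N12|N21] := Ftot _ _ FN1 FN2; [exists N2|exists N1]; split; auto.
  right; split; last first.
    move=> z xz [N FN Nz]; have [N0'|[_]] := FP _ FN; last exact.
    by move: Nz; rewrite N0'.
  apply/submoduleP; split.
    exists N0 => //; have [//|[sN _]] := FP _ FN0; exact: submodule0.
  move=> a y z Fy Fz; have [N [FN Ny Nz]] := F2 _ _ Fy Fz; exists N => //.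
  have [N0'|[sN _]] := FP _ FN; first by move: Ny; rewrite N0'.
  by apply: submoduleD => //; apply: submoduleZ.
have [sN Nx] : submodule N /\ forall z, cyclic x z -> N z -> z = 0.
  case: PN => // N0; case: (maxN [set 0]).
    by rewrite N0; split=> // /(_ 0); apply.
  by right; split=> //; apply: submodule_set0.
have sS : submodule (sumset (cyclic x) N).
  by apply: submodule_sumset => //; apply: submodule_cyclic.
exists N; split=> //.
  apply/seteqP; split=> [z [xz Nz]|_ ->]; first exact: Nx.
  by split; [apply: (submodule0 (submodule_cyclic x))|apply: submodule0].
apply/seteqP; split=> // y0 _; have [es [pes E1]] := one_sum_primitive artA.
rewrite -[y0]scale1r E1 scaler_suml big_seq; apply: submodule_sum => // f fes.
have pf := pes f fes; have ff := primitive_idem pf; have ee := primitive_idem pe.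
pose y := f *: y0; have fy : f *: y = y by rewrite scalerA ff.
rewrite -/y; apply: contrapT => nSy.
pose I : set (A^o : lmodType A) := [set a | a * f = a /\ sumset (cyclic x) N (a *: y)].
have sI : submodule I.
  apply/submoduleP; split.
    split; first exact: mul0r.
    by rewrite scale0r; apply: submodule0.
  move=> c a1 a2 [af Sa] [af' Sa']; split; first by rewrite mulrDl regularZ -mulrA af af'.
  by rewrite scalerDl regularZ -scalerA; apply: submoduleD => //; apply: submoduleZ.
have [a []//|r [g [pg [rf Sr] gr gen]]] := left_uniserial_principal artA luni pf sI.
have gg := primitive_idem pg.
suff [t ft Nt] : exists2 t, f * t = t & N (r *: (y - t *: x)).
  pose y' := y - t *: x.
  have fy' : f *: y' = y' by rewrite scalerBr fy scalerA ft.
  have sN' : submodule (sumset N (cyclic y')).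
    by apply: submodule_sumset => //; apply: submodule_cyclic.
  have Ny' : N y'.
    apply: contrapT => nNy'; apply: (maxN (sumset N (cyclic y'))).
      split; first by apply: sumset_subl; apply: (submodule0 (submodule_cyclic y')).
      move=> /(_ y') NN; apply/nNy'/NN/sumset_subr; [exact: submodule0|exact: cyclic_id].
    right; split=> // z [c zE] [n Nn [_ [a ->] zE']]; apply: Nx; first by exists c.
    suff Nay : N (a *: y') by rewrite zE'; apply: submoduleD.
    have [|d dE] := gen (a * f).
      split; first by rewrite -mulrA ff.
      rewrite -scalerA fy; exists (c *: x + a *: (t *: x)).
        by rewrite scalerA -scalerDl; exists (c + a * t).
      exists (- n); first exact: submoduleN.
      have ay' : a *: y' = z - n by rewrite zE' addrC addKr.
      by rewrite -zE addrAC -ay' scalerBr subrK.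
    by rewrite -fy' scalerA dE -scalerA; apply: submoduleZ.
  apply: nSy; exists (t *: x); first by exists t.
  by exists y' => //; rewrite /y' addrC subrK.
have [_ [b0 ->] [n Nn ryE]] := Sr.
(* Multiplying the relation by [g] replaces [n] by [g *: n] and puts both coefficients [r] and [s]
   in the uniserial right ideal [g A]. *)
pose s := g * b0 * e.
have gs : g * s = s by rewrite /s !mulrA gg.
have se : s * e = s by rewrite /s -!mulrA ee.
have sxE : s *: x = r *: y - g *: n.
  by rewrite -gr -scalerA ryE scalerDr addrK scalerA /s -scalerA ex.
have Nsx : N (r *: y - s *: x).
  by rewrite sxE subKr; apply: submoduleZ.
have [sx0|sx0] := pselect (s *: x = 0).
  by exists 0; rewrite ?mulr0 // scale0r subr0; move: Nsx; rewrite sx0 subr0.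
have case1 t : s = r * t -> exists2 t, f * t = t & N (r *: (y - t *: x)).
  move=> sE; exists (f * t); first by rewrite mulrA ff.
  by rewrite scalerBr scalerA mulrA rf -sE.
have [[c rE]|[c sE]] := runi pg gr gs; last exact: case1 sE.
pose t := e * c * f.
have et : e * t = t by rewrite /t !mulrA ee.
have tf : t * f = t by rewrite /t -!mulrA ff.
have st : s * t = r by rewrite /t !mulrA se -rE rf.
have [Jt|nJt] := pselect (radical t); last first.
  have [u [_ _ _ tu]] := nonradical_inv pe pf et tf nJt.
  by apply: (case1 u); rewrite -st -mulrA tu se.
pose x' := t *: y.
have sx' : s *: x' = r *: y by rewrite scalerA st.
pose a := b * e.
have ae : a * e = a by rewrite /a -mulrA ee.
have ax : a *: x <> 0 by rewrite /a -scalerA ex.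
have ax' : a *: x' = 0.
  by rewrite scalerA /a -mulrA et; apply: Jk1; apply: radical_powerS.
(* Here [a] kills [x'], as [a * t] is in the next radical power, but it does not kill [x]. If [s] is
   a multiple of [a], then [s *: x] is in [N]; if [a] is a multiple of [s], then [a *: x] is in [N].
   Both are nonzero elements of [cyclic x]. *)
have [[d sE]|[d aE]] := luni pe se ae.
  case: sx0; apply: Nx; first by exists s.
  have sx'0 : s *: x' = 0 by rewrite sE -scalerA ax' scaler0.
  by move: Nsx; rewrite -sx' sx'0 sub0r => /(submoduleN sN); rewrite opprK.
case: ax; apply: Nx; first by exists a.
have dsx' : d *: (s *: x') = 0 by rewrite (scalerA d s) -aE ax'.
have := submoduleZ d sN Nsx; rewrite -sx' scalerBr dsx' scalerA -aE sub0r.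
by move=> /(submoduleN sN); rewrite opprK.
Qed.

End SerialModules.

(** * Torsion-free subquotients and their simple objects *)

Section TorsionFree.
Variable A : pzRingType.
Hypothesis artA : artinian (A^o : lmodType A).
Hypothesis luni : forall e : A, primitive e -> left_uniserial e.
Hypothesis runi : forall e : A, primitive e -> right_uniserial e.
Variable F : fgmod A -> Prop.
Hypothesis torF : torsion_free_class F.

Definition torsion_free_subquo (M : fgmod A) (U V : set M) : Prop :=
  exists2 C : fgmod A, F C & subquo_iso U V [set 0] [set: C].

Section Subquotients.
Variable M : fgmod A.
Implicit Types U V W : set M.

Lemma torsion_free_subquo_submodule U V :
  torsion_free_subquo U V -> [/\ submodule U, submodule V & U `<=` V].
Proof. by move=> [C _ /subquo_iso_submodule]. Qed.

Section Orthogonality.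
Variable T : fgmod A -> Prop.
Hypothesis TF : torsion_pair T F.

(** [B] is a linear relation inducing a map [K -> V / U]; the conclusion is that
    this map vanishes. *)
Definition orthogonal_to_torsion U V : Prop := forall (K : fgmod A) (B : K -> M -> Prop),
  T K -> linear_rel B -> (forall k, exists x, B k x) ->
  (forall k x, B k x -> V x) -> (forall x, B 0 x -> U x) ->
  forall k x, B k x -> U x.

(** Membership in [F] is orthogonality to [T]: the torsion part of a module receiving only zero maps
    from [T] vanishes, so the module is its own torsion-free part. The closure properties of [F]
    thereby reduce to inclusions of submodules. *)
Lemma torsion_free_subquoP U V :
  torsion_free_subquo U V <->
  [/\ submodule U, submodule V, U `<=` V & orthogonal_to_torsion U V].
Proof.
have [_ isoF orth seq] := TF; split=> [tfUV|[sU sV UV orthUV]].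
  have [sU sV UV] := torsion_free_subquo_submodule tfUV.
  have [C FC [G GP]] := tfUV; split=> // K B TK linB Btot BV B0.
  have [linG [GV GV' GU GU']] := GP.
  pose H k c := exists2 x, B k x & G x c.
  have linH : linear_rel H.
    split; first by exists 0; [case: linB|case: linG].
    move=> a k k' c c' [x Bx Gx] [x' Bx' Gx'].
    by exists (a *: x + x'); [apply: linB.2|apply: linG.2].
  have [k|c [x /B0/GU Gx0 Gxc]|f fP] := linear_rel_function linH.
  - have [x Bkx] := Btot k; have /GV[c Gxc] := BV k x Bkx.
    by exists c, x.
  - by have := subquo_graph_unique GP Gxc Gx0; rewrite subr0.
  move=> k x Bkx; have /GV[c Gxc] := BV k x Bkx.
  have /fP cE : H k c by exists x.
  by apply/GU; rewrite -(orth K C f TK FC k) -cE.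
have [Z [G GP]] := subquotient_fgmod artA luni sU sV UV.
exists Z; last by exists G.
have [linG [GV GV' GU GU']] := GP.
have [TZ [FZ [i [p [TTZ FFZ [injI surjP exact]]]]]] := seq Z.
have i0 k : i k = 0.
  have /GV'[x Gx] : [set: Z] (i k) by [].
  apply/GU'; rewrite -(subrr x); rewrite -[i k]subr0; apply: (linear_relB linG Gx); apply/GU.
  apply: (orthUV TZ (fun k x => G x (i k)) TTZ) Gx.
  - by split=> [|a k1 x1 k2 x2 G1 G2]; rewrite ?linear0 ?linearP; [case: linG|apply: linG.2].
  - by move=> k'; apply/GV'.
  - by move=> k' x' G'; apply/GV; exists (i k').
  - by move=> x'; rewrite linear0 => /GU.
apply: (isoF FZ Z) => //.
have injp z : p z = 0 -> z = 0.
  move=> pz; have : (p @^-1` [set 0]) z by [].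
  by rewrite -exact => -[k _ <-].
have [|||f fP] := @linear_rel_function _ FZ Z (fun y z => y = p z).
- by split=> [|a y z y' z' -> ->]; rewrite ?linear0 ?linearP.
- by move=> y; have [z _ <-] : range p y by [rewrite surjP]; exists z.
- by move=> z /esym/injp.
exists f, p => y; first by apply/esym; apply/fP.
by apply/esym/fP.
Qed.

End Orthogonality.

Lemma torsion_free_subquo_sub U W V : torsion_free_subquo U V -> submodule W ->
  U `<=` W -> W `<=` V -> torsion_free_subquo U W.
Proof.
have [T TF] := torF; move=> /(torsion_free_subquoP TF)[sU sV UV orthUV] sW UW WV.
apply/(torsion_free_subquoP TF); split=> // K B TK linB Btot BW B0 k x.
by apply: (orthUV K) => // k' x' /BW/WV.
Qed.

Lemma torsion_free_subquoI U1 U2 V : torsion_free_subquo U1 V ->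
  torsion_free_subquo U2 V -> torsion_free_subquo (U1 `&` U2) V.
Proof.
have [T TF] := torF; move=> /(torsion_free_subquoP TF)[sU1 sV UV1 orth1].
move=> /(torsion_free_subquoP TF)[sU2 _ UV2 orth2].
apply/(torsion_free_subquoP TF); split=> //; first exact: submoduleI.
  by move=> x [/UV1].
move=> K B TK linB Btot BV B0 k x Bkx; split.
  by apply: (orth1 K B) Bkx => // x' /B0[].
by apply: (orth2 K B) Bkx => // x' /B0[].
Qed.

(** A map from a torsion module to [V / U] vanishes in [V / W], hence lands in [W / U] and is
    zero. *)
Lemma torsion_free_subquo_trans U W V : torsion_free_subquo U W ->
  torsion_free_subquo W V -> torsion_free_subquo U V.
Proof.
have [T TF] := torF; move=> /(torsion_free_subquoP TF)[sU sW UW orthUW].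
move=> /(torsion_free_subquoP TF)[_ sV WV orthWV].
apply/(torsion_free_subquoP TF); split=> //; first by move=> x /UW/WV.
move=> K B TK linB Btot BV B0; apply: orthUW => //.
by apply: (orthWV K) => // x /B0/UW.
Qed.

End Subquotients.

Lemma torsion_free_subquo_iso (M N : fgmod A) (U V : set M) (U' V' : set N) :
  subquo_iso U V U' V' -> torsion_free_subquo U V -> torsion_free_subquo U' V'.
Proof.
move=> /subquo_iso_sym isoUV [C FC isoC]; exists C => //.
exact: subquo_iso_trans isoUV isoC.
Qed.

(** [V / U] is a simple object of [F]. *)
Definition simple_subquo (M : fgmod A) (U V : set M) : Prop :=
  [/\ torsion_free_subquo U V, ~ V `<=` U &
  forall W, submodule W -> U `<=` W -> W `<=` V -> torsion_free_subquo W V ->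
    W = U \/ W = V].

Lemma simple_subquo_iso (M N : fgmod A) (U V : set M) (U' V' : set N) :
  subquo_iso U V U' V' -> simple_subquo U V -> simple_subquo U' V'.
Proof.
move=> isoUV [tfUV nVU simUV].
have tfUV' := torsion_free_subquo_iso isoUV tfUV.
have [sU sV UV] := torsion_free_subquo_submodule tfUV.
have [sU' sV' UV'] := torsion_free_subquo_submodule tfUV'.
have [G GP] := isoUV; have GP' := subquo_graph_sym GP.
have U_E := graph_image_low GP'; have V_E := graph_image_top GP'.
split=> // [V'U'|W' sW' UW' WV' tfW'].
  by apply: nVU; rewrite -U_E -V_E; apply: graph_imageS.
pose W := graph_image (fun y x => G x y) W'.
have sW : submodule W := submodule_graph_image GP' sW'.
have UW : U `<=` W by rewrite -U_E; apply: graph_imageS.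
have WV : W `<=` V by rewrite -V_E; apply: graph_imageS.
have tfW : torsion_free_subquo W V.
  rewrite -{1}V_E; apply: (torsion_free_subquo_iso _ tfW').
  by apply: (subquo_graph_restrict GP').
have <- : graph_image G W = W' := graph_imageK GP' sW' UW' WV'.
case: (simUV W sW UW WV tfW) => ->; [left|right].
  exact: graph_image_low GP.
exact: graph_image_top GP.
Qed.

(** In the simple object [C], an element [x = e *: y] of maximal Loewy length generates a direct
    summand, with complement [K]. As [C / K] is isomorphic to [cyclic x], a submodule of [C], it is
    in [F]; so [K] is [0] or [C], and [x <> 0] excludes [C]. *)
Lemma simple_subquo_generator (M : fgmod A) (W V : set M) : simple_subquo W V ->
  exists (e : A) (x : M), [/\ primitive e, e *: x = x & V = sumset W (cyclic x)].
Proof.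
move=> simWV; have [[C FC isoC] nVW _] := simWV.
have [tf0 C0 sim] := simple_subquo_iso isoC simWV.
have [G GP] := isoC; have [linG [GV GV' GU GU']] := GP.
have [N JN] := radical_nilpotent artA luni.
(* The condition [J ^ k C <> 0]; the last such [k] is the Loewy length minus one. *)
pose P k := exists2 b : A, radical_power k b & exists y : C, b *: y <> 0.
have [k [Pk nPk]] : exists k, P k /\ ~ P k.+1.
  apply: contrapT => no; have [b /JN -> [y]] : P N; last by rewrite scale0r.
  elim: (N) => [|k Pk]; last by apply: contrapT => nPk; apply: no; exists k.
  exists 1 => //; apply: contrapT => noy; apply: C0 => y _; apply: contrapT => y0.
  by apply: noy; exists y; rewrite scale1r.
have [b kb [y by0]] := Pk; have [es [pes E1]] := one_sum_primitive artA.
have [e ees bey] : exists2 e, e \in es & b *: (e *: y) <> 0.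
  apply: contrapT => no; apply: by0.
  rewrite -[y]scale1r E1 scaler_suml scaler_sumr big_seq big1 // => e ees.
  by apply: contrapT => ey; apply: no; exists e.
have pe := pes _ ees; have ee := primitive_idem pe.
pose x := e *: y; have ex : e *: x = x by rewrite scalerA ee.
have [||K [sK xK xKT]] := cyclic_complement artA luni runi (M := C) (k := k) pe ex.
- by exists b.
- move=> b' y' kb'; apply: contrapT => by'; apply: nPk.
  by exists b' => //; exists y'.
have sx := submodule_cyclic x.
have xT : cyclic x = [set: C].
  have isoK := subquo_iso_sum_cap sx sK.
  rewrite xK xKT in isoK.
  have x0 : [set 0] `<=` cyclic x by move=> _ ->; apply: submodule0.
  have K0 : [set 0] `<=` K by move=> _ ->; apply: submodule0.
  have tfx := torsion_free_subquo_sub tf0 sx x0 (@subsetT _ _).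
  have [KE|KE] := sim K sK K0 (@subsetT _ _) (torsion_free_subquo_iso isoK tfx).
    by rewrite -xKT KE; apply/esym/sumset0.
  case: bey; rewrite -/x; suff -> : x = 0 by rewrite scaler0.
  have : (cyclic x `&` K) x by rewrite KE; split=> //; apply: cyclic_id.
  by rewrite xK.
have /GV'[v Gvx] : [set: C] x by [].
have Gex : G (e *: v) x by rewrite -ex; apply: linear_relZ.
exists e, (e *: v); split=> //; first by rewrite scalerA ee.
have [sW sV WV] := subquo_graph_submodule GP.
apply/seteqP; split.
  move=> w /GV[c Gwc]; have [a cE] : cyclic x c by rewrite xT.
  exists (w - a *: (e *: v)); last by exists (a *: (e *: v)); [exists a|rewrite subrK].
  by apply/GU; rewrite -(subrr c) {2}cE; apply: linear_relB => //; apply: linear_relZ.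
by apply: sumset_min => //; apply: cyclic_min => //; apply/GV; exists x.
Qed.

End TorsionFree.

(** * The Jordan-Hölder theorem for submodules *)

Section JordanHolder.
Variable A : pzRingType.
Hypothesis artA : artinian (A^o : lmodType A).
Hypothesis luni : forall e : A, primitive e -> left_uniserial e.
Hypothesis runi : forall e : A, primitive e -> right_uniserial e.
Variable F : fgmod A -> Prop.
Hypothesis torF : torsion_free_class F.
Variable M : fgmod A.
Implicit Types U V W : set M.

Local Notation simple_subquo := (@simple_subquo A F M).
Local Notation tf := (@torsion_free_subquo A F M).

(** Let [x] generate [V / W] and [x'] generate [V / W'], and let [a] be the coefficient of [x] along
    [x'] modulo [W']. If [a] is outside the radical, it is invertible and [x] generates [V / W'] as
    well. *)
Lemma simple_subquo_common_generator W W' V :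
  simple_subquo W V -> simple_subquo W' V -> ~ V `<=` sumset W W' ->
  exists (e : A) (x : M), [/\ primitive e, e *: x = x,
    V = sumset W (cyclic x) & V = sumset W' (cyclic x)].
Proof.
move=> simW simW' nVZ.
have [tfW _ _] := simW; have [sW sV WV] := torsion_free_subquo_submodule tfW.
have [tfW' _ _] := simW'; have [sW' _ W'V] := torsion_free_subquo_submodule tfW'.
have sZ := submodule_sumset sW sW'.
have WZ : W `<=` sumset W W' by apply: sumset_subl; apply: submodule0.
have W'Z : W' `<=` sumset W W' by apply: sumset_subr; apply: submodule0.
have [e [x [pe ex VE]]] := simple_subquo_generator artA luni runi torF simW.
have [f [x' [pf fx' VE']]] := simple_subquo_generator artA luni runi torF simW'.
have ee := primitive_idem pe; have ff := primitive_idem pf.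
have Vx : V x by rewrite VE; apply: sumset_subr (cyclic_id x); apply: submodule0.
have Vx' : V x' by rewrite VE'; apply: sumset_subr (cyclic_id x'); apply: submodule0.
exists e, x; split=> //.
have [w' Ww' [_ [b ->] xE]] : sumset W' (cyclic x') x by rewrite -VE'.
pose a := e * b * f.
have xaE : x - a *: x' = e *: w'.
  by rewrite -{1}ex xE scalerDr /a -!scalerA fx' addrK.
have ea : e * a = a by rewrite /a !mulrA ee.
have af : a * f = a by rewrite /a -!mulrA ff.
have [Ja|nJa] := pselect (radical a); last first.
  have [u [fu _ ua _]] := nonradical_inv pe pf ea af nJa.
  apply/seteqP; split; last by apply: sumset_min => //; apply: cyclic_min.
  rewrite VE'; apply: sumset_min.
  - by apply: submodule_sumset => //; apply: submodule_cyclic.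
  - by apply: sumset_subl; apply: (submodule0 (submodule_cyclic x)).
  apply: cyclic_min; first by apply: submodule_sumset => //; apply: submodule_cyclic.
  exists (- (u *: (e *: w'))).
    by apply: submoduleN => //; do 2! apply: submoduleZ => //.
  exists (u *: x); first by exists u.
  by rewrite -xaE scalerBr scalerA ua fx' opprB subrK.
have [w Ww [_ [c ->] xE']] : sumset W (cyclic x) x' by rewrite -VE.
(* With [a] in the radical, [x'] is congruent to [(c * a) *: x'] modulo [W + W']; iterating, [x'] is
   congruent to [0] by nilpotency, so [V] lies in [W + W']. *)
have Zx' : sumset W W' (x' - (c * a) *: x').
  have -> : x' - (c * a) *: x' = w + c *: (e *: w').
    by rewrite -xaE scalerBr -scalerA addrA -xE'.
  exists w => //; exists (c *: (e *: w')) => //.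
  by do 2! apply: submoduleZ => //.
have [N JN] := radical_nilpotent artA luni.
case: nVZ; rewrite VE'; apply: sumset_min => //; apply: cyclic_min => //.
suff [d /JN -> ] : exists2 d, radical_power N d & sumset W W' (x' - d *: x').
  by rewrite scale0r subr0.
elim: (N) => [|n [d nd Zd]].
  by exists 1 => //; rewrite scale1r subrr; apply: submodule0.
exists (d * (c * a)); first by apply: radical_powerS => //; apply: radicalMl.
have -> : x' - (d * (c * a)) *: x' = (x' - d *: x') + d *: (x' - (c * a) *: x').
  by rewrite scalerBr scalerA addrA subrK.
by apply: submoduleD => //; apply: submoduleZ.
Qed.

(** The inclusion of annihilators makes [a *: x |-> a *: x] a well-defined surjection from [V / W]
    to [V / W']. Its kernel has quotient in [F], so by simplicity of [V / W] it is zero or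
    everything, and [V / W' <> 0] excludes the latter. *)
Lemma simple_subquo_graph W W' V (x : M) :
  simple_subquo W V -> simple_subquo W' V ->
  V = sumset W (cyclic x) -> V = sumset W' (cyclic x) ->
  (forall a : A, W (a *: x) -> W' (a *: x)) ->
  subquo_graph W V W' V (fun y y' => exists2 a : A, W (y - a *: x) & W' (y' - a *: x)).
Proof.
move=> simW simW' VE VE' WW'; set G := (fun y y' : M => _).
have [tfW _ sim] := simW; have [sW sV WV] := torsion_free_subquo_submodule tfW.
have [tfW' nVW' _] := simW'; have [sW' _ W'V] := torsion_free_subquo_submodule tfW'.
have Vx : V x by rewrite VE; apply: sumset_subr (cyclic_id x); apply: submodule0.
have linG : linear_rel G.
  split; first by exists 0; rewrite scale0r subr0; apply: submodule0.
  move=> b y z y' z' [a Wa Wa'] [c Wc Wc']; exists (b * a + c).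
    rewrite scalerDl -scalerA opprD addrACA -scalerBr.
    by apply: submoduleD => //; apply: submoduleZ.
  by rewrite scalerDl -scalerA opprD addrACA -scalerBr; apply: submoduleD => //; apply: submoduleZ.
have GV y : V y <-> exists y', G y y'.
  split=> [|[y' [a Wa _]]]; last first.
    by rewrite -(subrK (a *: x) y); apply: submoduleD; [| exact: WV|apply: submoduleZ].
  rewrite {1}VE => -[w Ww [_ [a ->] ->]]; exists (a *: x), a; first by rewrite addrK.
  by rewrite subrr; apply: submodule0.
have GV' y' : V y' <-> exists y, G y y'.
  split=> [|[y [a _ Wa]]]; last first.
    by rewrite -(subrK (a *: x) y'); apply: submoduleD; [| exact: W'V|apply: submoduleZ].
  rewrite {1}VE' => -[w Ww [_ [a ->] ->]]; exists (a *: x), a; last by rewrite addrK.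
  by rewrite subrr; apply: submodule0.
have GW' y' : W' y' <-> G 0 y'.
  split=> [Wy'|[a]].
    by exists 0; rewrite scale0r ?subr0 //; apply: submodule0.
  rewrite sub0r => /(submoduleN sW); rewrite opprK => /WW' Wa Wy'.
  by rewrite -(subrK (a *: x) y'); apply: submoduleD.
have G0P : subquo_graph [set y | G y 0] V W' V G by split.
have [sW0 _ W0V] := subquo_graph_submodule G0P.
have W_W0 : W `<=` [set y | G y 0].
  by move=> y Wy; exists 0; rewrite scale0r ?subr0 //; apply: submodule0.
have tf0 : tf [set y | G y 0] V.
  by apply: torsion_free_subquo_iso tfW'; apply: subquo_iso_sym; exists G.
case: (sim _ sW0 W_W0 W0V tf0) => W0E; first by rewrite -[in X in subquo_graph X]W0E.
case: nVW' => y' /GV'[y Gy].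
have Vy : V y by apply/GV; exists y'.
have Gy0 : G y 0 by move: Vy; rewrite -{1}W0E.
by have := subquo_graph_unique G0P Gy Gy0; rewrite subr0.
Qed.

Lemma simple_subquo_iso_noncomaximal W W' V :
  simple_subquo W V -> simple_subquo W' V -> ~ V `<=` sumset W W' ->
  subquo_iso W V W' V /\ subquo_iso (W `&` W') W (W `&` W') W'.
Proof.
move=> simW simW' nVZ.
have [e [x [pe ex VE VE']]] := simple_subquo_common_generator simW simW' nVZ.
(* The annihilators of [x] modulo [W] and [W'] are comparable because [A e] is uniserial, and the
   conclusion is symmetric. *)
wlog WW' : W W' simW simW' VE VE' nVZ / forall a : A, W (a *: x) -> W' (a *: x).
  move=> wl; have ee := primitive_idem pe.
  have [WW'|/existsNP[a /not_implyP[Wa nWa]]] := pselect (forall a : A, W (a *: x) -> W' (a *: x)).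
    exact: wl.
  have nVZ' : ~ V `<=` sumset W' W by rewrite sumsetC.
  suff W'W (b : A) : W' (b *: x) -> W (b *: x).
    have [/subquo_iso_sym isoV /subquo_iso_sym isoD] := wl W' W simW' simW VE' VE nVZ' W'W.
    by rewrite setIC.
  move=> Wb; apply: contrapT => nWb.
  have [tfW _ _] := simW; have [sW _ _] := torsion_free_subquo_submodule tfW.
  have [tfW' _ _] := simW'; have [sW' _ _] := torsion_free_subquo_submodule tfW'.
  have aeE c : (c * e) *: x = c *: x by rewrite -scalerA ex.
  have [||[c cE]|[c cE]] := luni pe (a := a * e) (b := b * e).
  - by rewrite -mulrA ee.
  - by rewrite -mulrA ee.
  - by apply: nWa; rewrite -aeE cE -scalerA aeE; apply: submoduleZ.
  - by apply: nWb; rewrite -aeE cE -scalerA aeE; apply: submoduleZ.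
have GP := simple_subquo_graph simW simW' VE VE' WW'; set G := (fun _ => _) in GP.
have [tfW _ _] := simW; have [sW sV WV] := torsion_free_subquo_submodule tfW.
have [tfW' _ _] := simW'; have [sW' _ W'V] := torsion_free_subquo_submodule tfW'.
split; first by exists G.
pose Z := sumset W W'.
have sZ : submodule Z by apply: submodule_sumset.
have WZ : W `<=` Z by apply: sumset_subl; apply: submodule0.
have W'Z : W' `<=` Z by apply: sumset_subr; apply: submodule0.
have ZV : Z `<=` V by apply: sumset_min.
(* The isomorphism is the identity modulo [Z], so it carries [Z / W] to [Z / W']; the second
   isomorphism theorem turns these into [W' / (W & W')] and [W / (W & W')]. *)
have GZ y y' : G y y' -> Z (y - y').
  move=> [a /WZ Wa /W'Z Wa'].
  have -> : y - y' = (y - a *: x) - (y' - a *: x) by rewrite opprB addrA subrK.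
  exact: submoduleB.
have imZ : graph_image G Z = Z.
  apply/seteqP; split=> [y' [y Zy Gy]|y' Zy'].
    by rewrite -(subKr y y'); apply: submoduleB => //; apply: GZ.
  have [_ [_ GV' _ _]] := GP; have /GV'[y Gy] := ZV _ Zy'.
  by exists y => //; rewrite -(subrK y' y); apply: submoduleD => //; apply: GZ.
have := subquo_graph_restrict GP sW sZ (fun _ => id) WZ ZV.
rewrite (graph_image_low GP) imZ => isoZ.
have iso1 := subquo_iso_sum_cap sW sW'.
have := subquo_iso_sum_cap sW' sW; rewrite setIC sumsetC => iso2.
apply: subquo_iso_trans iso1 _; apply: subquo_iso_sym.
exact: subquo_iso_trans iso2 isoZ.
Qed.

(** Boolean by classical logic, so that series become lists satisfying [path]. *)
Definition simple_rel U V : bool := `[< simple_subquo U V >].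

(** Isomorphism classes of subquotients, encoded within [M] so as to stay in a
    small universe. *)
Definition subquo_class U V : set (set M * set M) := [set p | subquo_iso U V p.1 p.2].

Lemma subquo_class_iso U V U' V' :
  subquo_iso U V U' V' -> subquo_class U V = subquo_class U' V'.
Proof.
move=> isoUV; apply/seteqP; split=> p; last exact: subquo_iso_trans.
by apply: subquo_iso_trans; apply: subquo_iso_sym.
Qed.

Lemma torsion_free_subquo_refl U : submodule U -> tf U U.
Proof.
have [T TF] := torF.
move=> sU; apply/(torsion_free_subquoP artA luni TF); split=> // K B TK linB Btot BU B0.
exact: BU.
Qed.

Lemma simple_path_torsion_free U p :
  submodule U -> path simple_rel U p -> tf U (last U p).
Proof.
elim: p U => [|V p IH] U sU /=; first by move=> _; apply: torsion_free_subquo_refl.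
move=> /andP[/asboolP[tfUV _ _] /IH tfV].
apply: (torsion_free_subquo_trans artA luni torF tfUV); apply: tfV.
by have [] := torsion_free_subquo_submodule tfUV.
Qed.

(** Induction on [l V]: among the proper [W] above [U] with [V / W] in [F], one of maximal [l] has a
    simple quotient [V / W]. *)
Lemma simple_path_exists U V : tf U V ->
  exists p, path simple_rel U p /\ last U p = V.
Proof.
have [l lP] := fin_gen_length artA luni (fgmod_fin_gen M).
move: {2}(l V).+1 (ltnSn (l V)) => n; elim: n V => [//|n IH] V lV tfUV.
have [sU sV UV] := torsion_free_subquo_submodule tfUV.
have [VU|nVU] := pselect (V `<=` U).
  by exists [::]; split=> //=; apply/seteqP.
pose P k := `[< exists W, [/\ U `<=` W, ~ V `<=` W, tf W V & l W = k] >].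
have exP : exists k, P k by exists (l U); apply/asboolP; exists U; split.
have bP k : P k -> (k <= l V)%N.
  move=> /asboolP[W [_ _ /torsion_free_subquo_submodule[sW _ WV] <-]].
  exact: length_fun_le lP sW sV WV (@subsetT _ _).
case: (ex_maxnP exP bP) => k /asboolP[W [UW nVW tfWV lW]] maxk.
have [sW _ WV] := torsion_free_subquo_submodule tfWV.
have simW : simple_subquo W V.
  split=> // W1 sW1 WW1 W1V tfW1.
  have [W1W|nW1W] := pselect (W1 `<=` W); first by left; apply/seteqP.
  right; apply/seteqP; split=> //; apply: contrapT => nVW1.
  have := lP W W1 sW sW1 WW1 (@subsetT _ _) nW1W.
  rewrite lW ltnNge maxk //; apply/asboolP; exists W1; split=> //.
  by move=> x /UW/WW1.
have lWV : (l W < n)%N.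
  by apply: leq_trans (lP W V sW sV WV (@subsetT _ _) nVW) _.
have [p [pp lastp]] := IH W lWV (torsion_free_subquo_sub artA luni torF tfUV sW UW WV).
exists (rcons p V); rewrite rcons_path last_rcons pp lastp; split=> //.
exact/asboolP.
Qed.

Lemma simple_path_transport U V U' V' p : subquo_iso U V U' V' ->
  path simple_rel U p -> last U p = V ->
  exists p', [/\ path simple_rel U' p', last U' p' = V' &
    pairmap subquo_class U' p' = pairmap subquo_class U p].
Proof.
move=> [G GP] pp lastp; have [sU sV UV] := subquo_graph_submodule GP.
have U'E := graph_image_low GP; have V'E := graph_image_top GP.
exists (map (graph_image G) p).
suff transport W q : submodule W -> U `<=` W -> path simple_rel W q -> last W q `<=` V ->
    path simple_rel (graph_image G W) (map (graph_image G) q) /\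
    pairmap subquo_class (graph_image G W) (map (graph_image G) q) = pairmap subquo_class W q.
  have [] := transport U p sU (fun _ => id) pp; first by rewrite lastp.
  by rewrite -U'E => pp' ->; split=> //; rewrite last_map lastp.
elim: q W => [//|W1 q IH] W sW UW /= /andP[/asboolP simW1 pq] lastq.
have [tfW _ _] := simW1; have [_ sW1 WW1] := torsion_free_subquo_submodule tfW.
have UW1 : U `<=` W1 by move=> x /UW/WW1.
have [_ _ W1l] := torsion_free_subquo_submodule (simple_path_torsion_free sW1 pq).
have iso1 := subquo_graph_restrict GP sW sW1 UW WW1 (subset_trans W1l lastq).
have [-> ->] := IH W1 sW1 UW1 pq lastq.
rewrite -(subquo_class_iso iso1) andbT; split=> //.
by apply/asboolP; apply: simple_subquo_iso simW1.
Qed.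

(** If [W + W' = V], both series have one step and their factors are exchanged. Otherwise the top
    factors are isomorphic, and a series from [W & W'] to [W] is transported to one ending at
    [W']. *)
Lemma simple_path_diamond W W' V : W <> W' ->
  simple_subquo W V -> simple_subquo W' V ->
  exists r r', [/\ path simple_rel (W `&` W') r, last (W `&` W') r = W,
    path simple_rel (W `&` W') r', last (W `&` W') r' = W' &
    perm_eq (rcons (pairmap subquo_class (W `&` W') r) (subquo_class W V))
            (rcons (pairmap subquo_class (W `&` W') r') (subquo_class W' V))].
Proof.
move=> neW simW simW'.
have [tfW _ sim] := simW; have [sW sV WV] := torsion_free_subquo_submodule tfW.
have [tfW' _ sim'] := simW'; have [sW' _ W'V] := torsion_free_subquo_submodule tfW'.
have [VZ|nVZ] := pselect (V `<=` sumset W W').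
  have ZV : sumset W W' = V by apply/seteqP; split=> //; apply: sumset_min.
  have iso1 := subquo_iso_sum_cap sW sW'; rewrite ZV in iso1.
  have iso2 := subquo_iso_sum_cap sW' sW; rewrite setIC sumsetC ZV in iso2.
  exists [:: W], [:: W']; rewrite /= !andbT; split=> //.
  - by apply/asboolP; apply: simple_subquo_iso simW'; apply: subquo_iso_sym.
  - by apply/asboolP; apply: simple_subquo_iso simW; apply: subquo_iso_sym.
  rewrite (subquo_class_iso iso1) (subquo_class_iso iso2).
  by rewrite -[[:: _; subquo_class W V]]/([:: _] ++ [:: _]) perm_catC.
have [isoV isoD] := simple_subquo_iso_noncomaximal simW simW' nVZ.
have tfDV := torsion_free_subquoI artA luni torF tfW tfW'.
have tfD : tf (W `&` W') W by apply: (torsion_free_subquo_sub artA luni torF tfDV sW) => // x [].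
have [r [pr lastr]] := simple_path_exists tfD.
have [r' [pr' lastr' rr']] := simple_path_transport isoD pr lastr.
by exists r, r'; rewrite rr' (subquo_class_iso isoV).
Qed.

(** Induction on the length of the top term: each series is compared, below its penultimate term,
    with one passing through [W & W'], and the diamond relates the two comparison series. *)
Lemma simple_path_perm_eq U p q : submodule U ->
  path simple_rel U p -> path simple_rel U q -> last U p = last U q ->
  perm_eq (pairmap subquo_class U p) (pairmap subquo_class U q).
Proof.
have [l lP] := fin_gen_length artA luni (fgmod_fin_gen M).
move=> sU; move: {2}(l (last U p)).+1 (ltnSn (l (last U p))) => n.
elim: n p q => [//|n IH] p q.
have not_nil s V : path simple_rel U (rcons s V) -> U <> V.
  rewrite rcons_path => /andP[/(simple_path_torsion_free sU)].
  by move=> /torsion_free_subquo_submodule[_ _ Ul] /asboolP[_ nVl _] UV; apply: nVl; rewrite -UV.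
case/lastP: p => [|p V]; case/lastP: q => [|q V'] lV pp qq; rewrite /= ?last_rcons //.
- by move=> /(not_nil _ _ qq).
- by move=> /esym/(not_nil _ _ pp).
move=> VV'; rewrite -{V'}VV' in qq *; rewrite last_rcons in lV.
move: pp qq; rewrite !rcons_path => /andP[pp /asboolP simW] /andP[qq /asboolP simW'].
set W := last U p in simW *; set W' := last U q in simW' *.
have lastE s : pairmap subquo_class U (rcons s V) =
    rcons (pairmap subquo_class U s) (subquo_class (last U s) V).
  by rewrite -cats1 pairmap_cat cats1.
have lt_l X : simple_subquo X V -> (l X < n)%N.
  move=> [/torsion_free_subquo_submodule[sX sV XV] nVX _].
  exact: leq_trans (lP X V sX sV XV (@subsetT _ _) nVX) _.
rewrite !lastE -/W -/W'.
have [WW'|neW] := pselect (W = W').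
  by rewrite -WW' -!cats1 perm_cat2r; apply: IH => //; apply: lt_l.
have [r [r' [pr lastr pr' lastr' rr']]] := simple_path_diamond neW simW simW'.
have tfUW := simple_path_torsion_free sU pp; rewrite -/W in tfUW.
have tfUW' := simple_path_torsion_free sU qq; rewrite -/W' in tfUW'.
have [_ sW UW] := torsion_free_subquo_submodule tfUW.
have [_ sW' UW'] := torsion_free_subquo_submodule tfUW'.
have tfUD : tf U (W `&` W').
  apply: (torsion_free_subquo_sub artA luni torF tfUW); first exact: submoduleI.
    by move=> x Ux; split; [apply: UW|apply: UW'].
  by move=> x [].
have [p0 [pp0 lastp0]] := simple_path_exists tfUD.
(* Used for [W] and for [W'] with the same path [p0] from [U] to [W & W'], which later cancels. *)
have comp s Y : path simple_rel (W `&` W') s -> last (W `&` W') s = last U Y ->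
    path simple_rel U Y -> simple_subquo (last U Y) V ->
    perm_eq (pairmap subquo_class U Y)
      (pairmap subquo_class U p0 ++ pairmap subquo_class (W `&` W') s).
  move=> ps lasts pY simY; have := pairmap_cat subquo_class U p0 s.
  rewrite lastp0 => <-; apply: IH => //.
  - exact: lt_l.
  - by rewrite cat_path pp0 lastp0.
  - by rewrite last_cat lastp0.
have E1 := comp r p pr lastr pp simW; have E2 := comp r' q pr' lastr' qq simW'.
rewrite -!cats1.
apply: perm_trans (perm_cat E1 (perm_refl _)) _.
rewrite perm_sym; apply: perm_trans (perm_cat E2 (perm_refl _)) _.
by rewrite -!catA perm_cat2l !cats1 perm_sym.
Qed.

End JordanHolder.

(** * Admissible subobjects as submodules *)

Section Subobjects.
Variable A : pzRingType.
Hypothesis artA : artinian (A^o : lmodType A).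
Hypothesis luni : forall e : A, primitive e -> left_uniserial e.
Variable F : fgmod A -> Prop.
Hypothesis torF : torsion_free_class F.
Variable X : fgmod A.
Implicit Types U V : subobj F X.

Local Notation tf := (@torsion_free_subquo A F X).

Definition subobj_image U : set X := range (subobj_map U).

Lemma subobj_map_inj U : injective (subobj_map U).
Proof. by have [N [p [_ _ _ []]]] := subobj_inflation U. Qed.

Lemma subobj_image_torsion_free U : tf (subobj_image U) setT.
Proof.
have [N [p [_ _ FN [_ surjp ex]]]] := subobj_inflation U.
exists N => //; exists (fun x y => y = p x); split.
  by split=> [|a x x' y y' -> ->]; rewrite ?linear0 ?linearP.
split=> x; split=> //.
- by exists (p x).
- by move=> _; have [z _ <-] : range p x by [rewrite surjp]; exists z.
- by rewrite /subobj_image ex => /esym.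
- by move=> px; rewrite /subobj_image ex; apply/esym.
- by move=> ->; rewrite linear0.
- by rewrite linear0.
Qed.

Lemma submodule_subobj_image U : submodule (subobj_image U).
Proof. by have [] := torsion_free_subquo_submodule (subobj_image_torsion_free U). Qed.

(** Both outer terms of the conflation are in [F]: [X / W] by hypothesis, and [W] as a submodule of
    [X]. *)
Lemma torsion_free_subobj (W : set X) : tf W setT -> F X ->
  exists U, subobj_image U = W.
Proof.
move=> tfW FX; have [sW _ _] := torsion_free_subquo_submodule tfW.
have W0 : [set 0] `<=` W by move=> _ ->; apply: submodule0.
have tf0 : tf [set 0] setT.
  exists X => //; apply: subquo_iso_refl => //; first exact: submodule_set0.
  exact: submodule_setT.
have tf0W := torsion_free_subquo_sub artA luni torF tf0 sW W0 (@subsetT _ _).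
have [Z FZ [G GP]] := tf0W; have [linG [GV GV' GU GU']] := GP.
have [N FN [H HP]] := tfW; have [linH [HV HV' HU HU']] := HP.
have GP' := subquo_graph_sym GP.
have [z|x /GU//|i iP] := @linear_rel_function _ Z X (fun z x => G x z) GP'.1.
  by apply/GV'.
have [x|y /HU'//|p pP] := linear_rel_function linH; first by apply/HV.
have infl : inflation F i.
  exists N, p; split=> //; split.
  - move=> z z' Ez; apply/eqP; rewrite -subr_eq0; apply/eqP.
    have Gz : G (i z) z by apply/iP.
    have Gz' : G (i z) z' by rewrite Ez; apply/iP.
    exact: (subquo_graph_unique GP Gz Gz').
  - apply/seteqP; split=> // y _; have /HV'[x /pP ->] : [set: N] y by [].
    by exists x.
  - apply/seteqP; split=> [_ [z _ <-]|x /= px0].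
      by apply/esym/pP/HU/GV; exists z; apply/iP.
    have /GV[z /iP ->] : W x by apply/HU/pP.
    by exists z.
exists (Subobj infl); apply/seteqP; split=> [_ [z _ <-]|x /GV[z /iP ->]].
  by apply/GV; exists z; apply/iP.
by exists z.
Qed.

Lemma subobj_over U V : subobj_image U `<=` subobj_image V ->
  exists h : {linear subobj_dom U -> subobj_dom V}, Defs.over h.
Proof.
move=> UV.
have [|x|y|h hP] := @linear_rel_function _ _ _
    (fun x y => subobj_map V y = subobj_map U x).
- by split=> [|a x x' y y' E E']; rewrite ?linear0 // !linearP E E'.
- by have [|y _ E] := UV (subobj_map U x); [exists x|exists y].
- by rewrite linear0 -(linear0 (subobj_map V)) => /subobj_map_inj.
by exists h => x; apply/hP.
Qed.

Lemma over_image U V (h : {linear subobj_dom U -> subobj_dom V}) :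
  Defs.over h -> subobj_image U `<=` subobj_image V.
Proof. by move=> hP _ [x _ <-]; exists (h x). Qed.

Lemma subquo_iso_factor U V (C : fgmod A) : F C ->
  subquo_iso (subobj_image U) (subobj_image V) [set 0] [set: C] -> is_factor U V C.
Proof.
move=> FC [G GP]; have [_ _ UV] := subquo_graph_submodule GP.
have [linG [GV GV' GU GU']] := GP; have [h hP] := subobj_over UV.
have [|y|c|p pP] := @linear_rel_function _ (subobj_dom V) C (fun y c => G (subobj_map V y) c).
- split=> [|a y y' c c' Gy Gy']; first by rewrite linear0; case: linG.
  by rewrite linearP; apply: linG.2.
- by apply/GV; exists y.
- by rewrite linear0 => /GU'.
exists h, p; split=> //.
have [_ [_ [FU _ _ _]]] := subobj_inflation U.
have [_ [_ [FV _ _ _]]] := subobj_inflation V.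
split=> //; split.
- by move=> x x' E; apply: (@subobj_map_inj U); rewrite -!hP E.
- apply/seteqP; split=> // c _; have /GV'[x Gxc] : [set: C] c by [].
  have [y _ yx] : subobj_image V x by apply/GV; exists c.
  by exists y => //; apply/esym/pP; rewrite yx.
- apply/seteqP; split=> [_ [x _ <-]|y /= py0].
    by apply/esym/pP/GU; rewrite hP; exists x.
  have [x _ xy] : subobj_image U (subobj_map V y) by apply/GU/pP.
  by exists x => //; apply: (@subobj_map_inj V); rewrite hP.
Qed.

Lemma subobj_image_sub U V : subobj_image U `<=` subobj_image V ->
  tf (subobj_image U) (subobj_image V).
Proof.
move=> UV; apply: (torsion_free_subquo_sub artA luni torF (subobj_image_torsion_free U)) => //.
exact: submodule_subobj_image.
Qed.

(** An inclusion of images is automatically an inflation: its cokernel embeds in [X / U], which is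
    in [F]. *)
Lemma subobj_leP U V : subobj_le U V <-> subobj_image U `<=` subobj_image V.
Proof.
split=> [[h [_ /over_image]]//|UV].
have [C FC isoC] := subobj_image_sub UV.
have [h [p [hP cp]]] := subquo_iso_factor FC isoC.
by exists h; split=> //; exists C, p.
Qed.

Lemma subobj_eqP U V : subobj_eq U V <-> subobj_image U = subobj_image V.
Proof.
split=> [[h [[g hK gK] hP]]|UV].
  apply/seteqP; split; first exact: (over_image hP).
  by move=> _ [y _ <-]; exists (g y); rewrite // -hP gK.
have [|h hP] := @subobj_over U V; first by rewrite UV.
have [|g gP] := @subobj_over V U; first by rewrite UV.
exists h; split=> //; exists g => x.
  by apply: (@subobj_map_inj U); rewrite gP hP.
by apply: (@subobj_map_inj V); rewrite hP gP.
Qed.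

(** A submodule [W] between consecutive terms with torsion-free quotient is admissible in [X] by
    extension closure and comparable to the whole series; maximality makes it a term of the
    series. *)
Lemma composition_series_simple n (s : 'I_n.+1 -> subobj F X) k : F X ->
  composition_series s -> (k < n)%N ->
  simple_subquo F (subobj_image (s (inord k))) (subobj_image (s (inord k.+1))).
Proof.
move=> FX [_ _ lt_s max_s] kn.
have ltk : (@inord n k < @inord n k.+1)%N.
  by rewrite !inordK // ltnS // ltnW.
have le_s (i j : 'I_n.+1) : (i <= j)%N -> subobj_image (s i) `<=` subobj_image (s j).
  rewrite leq_eqVlt => /orP[/eqP ij|/lt_s[/subobj_leP//]].
  by rewrite (val_inj ij).
have [/subobj_leP UV neUV] := lt_s _ _ ltk.
split=> [||W sW UW WV tfW].
- exact: subobj_image_sub.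
- by move=> VU; apply/neUV/subobj_eqP/seteqP.
have tfWT := torsion_free_subquo_trans artA luni torF tfW (subobj_image_torsion_free _).
have [w wW] := torsion_free_subobj tfWT FX.
have [i|i /subobj_eqP] := max_s w.
  rewrite !subobj_leP wW; have [ik|ki] := leqP i k; [right|left].
    by apply: subset_trans UW; apply: le_s; rewrite inordK // ltnS ltnW.
  by apply: (subset_trans WV); apply: le_s; rewrite inordK.
rewrite wW => WE; have [ik|ki] := leqP i k; [left|right]; apply/seteqP; split=> //.
  by rewrite WE; apply: le_s; rewrite inordK // ltnS ltnW.
by rewrite WE; apply: le_s; rewrite inordK.
Qed.

End Subobjects.

(** * From indexed series to lists, and the theorem *)

Lemma path_mkseq (T : eqType) (e : rel T) (f : nat -> T) n :
  (forall k, (k < n)%N -> e (f k) (f k.+1)) -> path e (f 0%N) (mkseq (fun k => f k.+1) n).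
Proof.
move=> ef; apply/(pathP (f 0%N)) => i; rewrite size_mkseq => iltn.
rewrite nth_mkseq //; case: i iltn => [|i] iltn /=; first exact: ef.
by rewrite nth_mkseq ?ef // ltnW.
Qed.

Lemma last_mkseq (T : Type) (f : nat -> T) n : last (f 0%N) (mkseq (fun k => f k.+1) n) = f n.
Proof.
case: n => // n; rewrite (last_nth (f 0%N)) size_mkseq /= nth_mkseq //.
Qed.

Lemma pairmap_mkseq (T S : Type) (g : T -> T -> S) (f : nat -> T) n :
  pairmap g (f 0%N) (mkseq (fun k => f k.+1) n) = mkseq (fun k => g (f k) (f k.+1)) n.
Proof.
apply: (@eq_from_nth _ (g (f 0%N) (f 0%N))); first by rewrite size_pairmap !size_mkseq.
move=> i; rewrite size_pairmap size_mkseq => iltn.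
rewrite (nth_pairmap (f 0%N)) ?size_mkseq // !nth_mkseq //.
by case: i iltn => [|i] iltn //=; rewrite nth_mkseq // ltnW.
Qed.

Lemma perm_eq_mkseqP (T : eqType) (a b : nat -> T) n :
  perm_eq (mkseq a n) (mkseq b n) ->
  exists2 sigma : 'I_n -> 'I_n, bijective sigma & forall i : 'I_n, a i = b (sigma i).
Proof.
have mkE (c : nat -> T) : mkseq c n = [tuple c i | i < n] :> seq T.
  by rewrite /mkseq -val_enum_ord -map_comp.
rewrite !mkE => /tuple_permP[p E].
exists p; first exact: injF_bij (@perm_inj _ p).
move=> i; have : [tuple a i | i < n] = [tuple tnth [tuple b i | i < n] (p i) | i < n].
  exact: val_inj.
by move=> /(congr1 (fun t => tnth t i)); rewrite !tnth_mktuple.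
Qed.

Theorem corollary5 (R : comPzRingType) (L : pzRingType) (iota : {rmorphism R -> L})
    (hartin : artin_algebra iota) (hnak : nakayama L)
    (F : fgmod L^c -> Prop) (hF : torsion_free_class F) :
  JHP F.
Proof.
have artA := artin_algebra_artinian hartin; have [uniR uniL] := hnak.
have luni (e : L^c) : primitive e -> left_uniserial e.
  exact: primitive_left_uniserial.
(* Right multiples in [L^c] are left multiples in [L]: the left projectives of [L] enter here. *)
have runi (e : L^c) : primitive e -> right_uniserial e.
  move=> pe; apply: converse_left_uniserial; apply: primitive_left_uniserial => //.
  exact: converse_primitive.
move=> X FX n m s t sP tP.
pose f k := subobj_image (s (inord k)); pose g k := subobj_image (t (inord k)).
have ends q (u : 'I_q.+1 -> subobj F X) : composition_series u ->
    subobj_image (u (inord 0)) = [set 0] /\ subobj_image (u (inord q)) = setT.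
  move=> [u0 [v _ uK] _ _].
  have -> : inord 0 = ord0 :> 'I_q.+1 by apply: val_inj; rewrite /= inordK.
  have -> : inord q = ord_max :> 'I_q.+1 by apply: val_inj; rewrite /= inordK.
  split; apply/seteqP; split=> //.
  - by move=> _ [x _ <-]; rewrite (u0 x) linear0.
  - by move=> _ ->; exists 0; rewrite ?linear0.
  - by move=> x _; exists (v x).
have [f0 fn] := ends _ _ sP; have [g0 gm] := ends _ _ tP.
have pf : path (simple_rel F (M := X)) (f 0%N) (mkseq (fun k => f k.+1) n).
  by apply: path_mkseq => k kn; apply/asboolP; apply: composition_series_simple.
have pg : path (simple_rel F (M := X)) (g 0%N) (mkseq (fun k => g k.+1) m).
  by apply: path_mkseq => k kn; apply/asboolP; apply: composition_series_simple.
have fg : f 0%N = g 0%N by rewrite /f /g f0 g0.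
have fgP : perm_eq (mkseq (fun k => subquo_class (f k) (f k.+1)) n)
                   (mkseq (fun k => subquo_class (g k) (g k.+1)) m).
  have pg' := pg; rewrite -fg in pg'.
  have fgE : last (f 0%N) (mkseq (fun k => f k.+1) n) = last (f 0%N) (mkseq (fun k => g k.+1) m).
    by rewrite last_mkseq fg last_mkseq /f fn.
  have sf : submodule (f 0%N) by apply: submodule_subobj_image.
  have := simple_path_perm_eq artA luni runi hF sf pf pg' fgE.
  by rewrite pairmap_mkseq fg pairmap_mkseq.
have := perm_size fgP; rewrite !size_mkseq => nm.
case: m / nm t tP @g pg g0 gm fg fgP => t tP g pg g0 gm fg fgP.
split=> //; have [sigma bij E] := perm_eq_mkseqP fgP.
exists sigma; split=> // i.
have inordE (u : 'I_n.+1 -> subobj F X) (j : 'I_n) :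
    u (widen_ord (leqnSn n) j) = u (inord j) /\ u (lift ord0 j) = u (inord j.+1).
  split; congr (u _); apply: ord_inj; last by rewrite lift0 inordK ?ltnS ?ltn_ord.
  by rewrite inordK ?ltnS 1?ltnW ?ltn_ord.
have [-> ->] := inordE s i; have [-> ->] := inordE t (sigma i).
have [[C FC isoC] _ _] := composition_series_simple artA luni hF FX sP (ltn_ord i).
have [tft _ _] := composition_series_simple artA luni hF FX tP (ltn_ord (sigma i)).
have [sU sV UV] := torsion_free_subquo_submodule tft.
(* The class of each subquotient contains the subquotient itself, so equal classes give an
   isomorphism, and the factor [C] of [s] serves for [t] too. *)
have isoE : subquo_class (f i) (f i.+1) (g (sigma i), g (sigma i).+1).
  by rewrite E; apply: subquo_iso_refl.
exists C, C; split.
- exact: subquo_iso_factor isoC.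
- apply: subquo_iso_factor => //; apply: subquo_iso_trans isoC.
  exact: subquo_iso_sym isoE.
- by exists idfun; exists id.
Qed.
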